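(* For every integer $n\ge0$: (1) $\displaystyle\mathrm B^{\mathrm B}_n(x,y)=\sum_{k=0}^n\binom nk\mathrm B_k(2x)y^{n-k}=\sum_{k=0}^n\binom nk\mathrm{Fe}_k(2x)(y+1)^{n-k}$; (2) $\displaystyle\mathrm B^{\mathrm D}_{n+1}(x,y)=\sum_{k=0}^n\binom nk\mathrm B^{\mathrm B}_k(x)y^{n-k}=\sum_{k=0}^n\binom nk\widetilde{\mathrm{Fe}}^{\mathrm B}_k(x)(y+1)^{n-k}$; (3) $\displaystyle\mathrm C^{\mathrm B}_n(x,y)=\sum_{k=0}^n\binom nk\mathrm{Mo}^{\mathrm B}_k(x)y^{n-k}=\sum_{k=0}^n\binom{2k}k\binom n{2k}x^k(y+1)^{n-2k}$; (4) $\displaystyle\mathrm C^{\mathrm D}_{n+1}(x,y)=\sum_{k=0}^n\binom nk\widetilde{\mathrm{Mo}}^{\mathrm B}_k(x)y^{n-k}=\sum_{k=0}^n\binom nk\binom k{\lfloor k/2\rfloor}x^{\lceil k/2\rceil}(y+1)^{n-k}$.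
   Context: A set partition of a finite set $\mathcal X\subset\mathbb Z$ is a set of nonempty pairwise disjoint sets (blocks) with union $\mathcal X$. A pair $(i,j)$ is an arc of $\Lambda$ if $i<j$ lie in the same block and $j$ is the least element of that block greater than $i$; $\mathrm{Arc}(\Lambda)$ is the set of arcs, $\mathrm{Cov}(\Lambda)=\{(i,j)\in\mathrm{Arc}(\Lambda):j=i+1\}$. A partition is feasible if every block has at least two elements, poor if every block has at most two elements, B-feasible if no block contains exactly one nonzero element, B-poor if no block contains more than two nonzero elements; $\binom{n}{2k}=0$ when $2k>n$. $\Pi(n)$ is the set of partitions of $[n]=\{1,\dots,n\}$; $\mathrm B_n(x)=\sum_{\Lambda\in\Pi(n)}x^{|\mathrm{Arc}(\Lambda)|}$, $\mathrm{Fe}_n(x)=\sum_{\text{feasible }\Lambda\in\Pi(n)}x^{|\mathrm{Arc}(\Lambda)|}$. With $[\pm n]=\{\pm1,\dots,\pm n\}$, $\Pi^{\mathrm B}(n)$ (resp. $\Pi^{\mathrm D}(n)$) is the set of partitions $\Lambda$ of $\{0\}\cup[\pm n]$ (resp. $[\pm n]$) with $(i,j)\in\mathrm{Arc}(\Lambda)$ iff $(-j,-i)\in\mathrm{Arc}(\Lambda)$, and $\widetilde{\mathrm{NC}}^{\mathrm X}(n)$ is the set of $\Lambda\in\Pi^{\mathrm X}(n)$ such that whenever $(i,k),(j,l)\in\mathrm{Arc}(\Lambda)$ with $i<j<k<l$ we have $(i,k)=(-l,-j)$. For $\mathrm X\in\{\mathrm B,\mathrm D\}$: $\mathrm B^{\mathrm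 X}_n(x,y)=\sum_{\Lambda\in\Pi^{\mathrm X}(n)}x^{|\mathrm{Arc}(\Lambda)\setminus\mathrm{Cov}(\Lambda)|/2}y^{|\mathrm{Cov}(\Lambda)|/2}$, $\mathrm C^{\mathrm X}_n(x,y)$ is the same sum over $\widetilde{\mathrm{NC}}^{\mathrm X}(n)$, $\mathrm B^{\mathrm B}_n(x)=\mathrm B^{\mathrm B}_n(x,x)$, $\widetilde{\mathrm{Fe}}^{\mathrm B}_n(x)=\sum_{\text{B-feasible }\Lambda\in\Pi^{\mathrm B}(n)}x^{|\mathrm{Arc}(\Lambda)|/2}$, $\mathrm{Mo}^{\mathrm B}_n(x)=\sum_{\text{poor }\Lambda\in\widetilde{\mathrm{NC}}^{\mathrm B}(n)}x^{|\mathrm{Arc}(\Lambda)|/2}$, $\widetilde{\mathrm{Mo}}^{\mathrm B}_n(x)=\sum_{\text{B-poor }\Lambda\in\widetilde{\mathrm{NC}}^{\mathrm B}(n)}x^{|\mathrm{Arc}(\Lambda)|/2}$.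
   Formalization: The sets Π^B(n) and Π^D(n) are restricted to partitions with no arc (−i,i); read literally such arcs are allowed, give half-integer powers of x and make the identities false, e.g. {−1,1},{0} adds x^{1/2} in (1) at n=1. *)

(* Defs.v *)
From mathcomp Require Import all_boot all_order all_algebra.
Set Implicit Arguments. Unset Strict Implicit. Unset Printing Implicit Defensive.
Import Order.TTheory GRing.Theory Num.Theory.
Local Open Scope ring_scope.

(* A finite set X of integers is represented by a finType T together with an
   injective labelling lab : T -> int whose image is X.  Set partitions of X
   are mathcomp partitions of [set: T]. *)

Section Generic.
Variables (T : finType) (lab : T -> int).

Definition setpart (P : {set {set T}}) : bool := partition P [set: T].

Definition is_arc (P : {set {set T}}) (a b : T) : bool :=
  [&& b \in pblock P a, lab a < lab b &
      [forall c, (c \in pblock P a) ==> ~~ ((lab a < lab c) && (lab c < lab b))]].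

Definition arcs (P : {set {set T}}) : {set T * T} :=
  [set p | is_arc P p.1 p.2].

Definition covs (P : {set {set T}}) : {set T * T} :=
  [set p in arcs P | lab p.2 == lab p.1 + 1].

Definition feasible (P : {set {set T}}) : bool := [forall B in P, 1 < #|B|]%N.
Definition poor (P : {set {set T}}) : bool := [forall B in P, #|B| <= 2]%N.
Definition nonzero_part (B : {set T}) : {set T} := [set t in B | lab t != 0].
Definition Bfeasible (P : {set {set T}}) : bool :=
  [forall B in P, #|nonzero_part B| != 1%N].
Definition Bpoor (P : {set {set T}}) : bool :=
  [forall B in P, #|nonzero_part B| <= 2]%N.

Variable neg : T -> T. (* lab (neg t) = - lab t *)

Definition arc_symmetric (P : {set {set T}}) : bool :=
  [forall a, forall b, is_arc P a b == is_arc P (neg b) (neg a)].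

Definition no_selfsym_arc (P : {set {set T}}) : bool :=
  [forall a, ~~ is_arc P (neg a) a].

Definition sym_part (P : {set {set T}}) : bool :=
  [&& setpart P, arc_symmetric P & no_selfsym_arc P].

Definition nc_sym (P : {set {set T}}) : bool :=
  [forall a, forall b, forall c, forall d,
     [&& is_arc P a c, is_arc P b d, lab a < lab b, lab b < lab c & lab c < lab d]
       ==> ((a == neg d) && (c == neg b))].

End Generic.

Definition labA (n : nat) (i : 'I_n) : int := (i : nat)%:Z + 1.
Definition labB (n : nat) (i : 'I_(2 * n + 1)) : int := (i : nat)%:Z - n%:Z.
Definition labD (n : nat) (i : 'I_(2 * n)) : int :=
  if (i < n)%N then (i : nat)%:Z - n%:Z else (i : nat)%:Z - n%:Z + 1. (* [+-n] *)
Definition negB (n : nat) (i : 'I_(2 * n + 1)) : 'I_(2 * n + 1) := rev_ord i.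
Definition negD (n : nat) (i : 'I_(2 * n)) : 'I_(2 * n) := rev_ord i.

Section Polys.
Variable R : comNzRingType.

Definition Bell (n : nat) (x : R) : R :=
  \sum_(P : {set {set 'I_n}} | setpart P) x ^+ #|arcs (@labA n) P|.
Definition Fe (n : nat) (x : R) : R :=
  \sum_(P : {set {set 'I_n}} | setpart P && feasible P) x ^+ #|arcs (@labA n) P|.

Definition wXY (T : finType) (lab : T -> int) (P : {set {set T}}) (x y : R) : R :=
  x ^+ (#|arcs lab P :\: covs lab P| %/ 2) * y ^+ (#|covs lab P| %/ 2).

Definition isBpart n (P : {set {set 'I_(2 * n + 1)}}) :=
  sym_part (@labB n) (@negB n) P.
Definition isDpart n (P : {set {set 'I_(2 * n)}}) :=
  sym_part (@labD n) (@negD n) P.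
Definition isNCB n (P : {set {set 'I_(2 * n + 1)}}) :=
  isBpart P && nc_sym (@labB n) (@negB n) P.
Definition isNCD n (P : {set {set 'I_(2 * n)}}) :=
  isDpart P && nc_sym (@labD n) (@negD n) P.

Definition BellB2 (n : nat) (x y : R) : R :=
  \sum_(P : {set {set 'I_(2 * n + 1)}} | isBpart P) wXY (@labB n) P x y.
Definition BellD2 (n : nat) (x y : R) : R :=
  \sum_(P : {set {set 'I_(2 * n)}} | isDpart P) wXY (@labD n) P x y.
Definition CatB2 (n : nat) (x y : R) : R :=
  \sum_(P : {set {set 'I_(2 * n + 1)}} | isNCB P) wXY (@labB n) P x y.
Definition CatD2 (n : nat) (x y : R) : R :=
  \sum_(P : {set {set 'I_(2 * n)}} | isNCD P) wXY (@labD n) P x y.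

Definition BellB (n : nat) (x : R) : R := BellB2 n x x.
Definition FeBt (n : nat) (x : R) : R :=
  \sum_(P : {set {set 'I_(2 * n + 1)}} | isBpart P && Bfeasible (@labB n) P)
     x ^+ (#|arcs (@labB n) P| %/ 2).
Definition MoB (n : nat) (x : R) : R :=
  \sum_(P : {set {set 'I_(2 * n + 1)}} | isNCB P && poor P)
     x ^+ (#|arcs (@labB n) P| %/ 2).
Definition MoBt (n : nat) (x : R) : R :=
  \sum_(P : {set {set 'I_(2 * n + 1)}} | isNCB P && Bpoor (@labB n) P)
     x ^+ (#|arcs (@labB n) P| %/ 2).

End Polys.

(* Main.v *)
Require Import Defs.
From mathcomp Require Import all_boot all_order all_algebra.
From mathcomp Require Import zify ring.
Set Implicit Arguments. Unset Strict Implicit. Unset Printing Implicit Defensive.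
Import Order.TTheory GRing.Theory Num.Theory.
Local Open Scope ring_scope.

(* A set partition is the same thing as its arc set, i.e. a set of increasing
   pairs in which every point starts at most one arc and ends at most one arc.
   A symmetric arc set on [-m-1, m+1] arises from one on [-m, m] by adding
   nothing, or by adding an arc (a, m+1) together with its mirror (-m-1, -a),
   where a starts no arc yet.  Hence each generating function is an iterate of a
   linear operator on functions of a small state:
   - for all partitions the state is the number of points that start no arc,
     refined to (singletons, others) when the feasible ones are selected;
   - for noncrossing partitions a must also be covered by no arc, and the state
     is the list of signs of such points.  Summing over the subsets of points
     that can still all be used turns this into a lattice path operator.
   The operators for B_n(x,y), C_n(x,y) differ from those for the one-variable
   polynomials by a multiple of the identity, and (T + c)^n expands by the
   binomial formula. *)

(** * Set partitions and arc sets *)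

(** The largest point m starts no arc, so it is always available, and among the arcs ending in m+1
    only (m, m+1) is a cover. This is the origin of the scalar y in the two-variable operators. For
    all partitions, the count of the other available points begins at 0 in type B and at 1 in type
    D. Setting y = x puts the largest point back into the count, which moves the beginning from 0 to
    1; hence [BellB] occurs in the type D formula. In type B the count stays even, and halving it
    turns x into 2x. The 1 in y + 1 comes from a change of test functions: if one decides in advance
    which points later arcs will start from, each new point has the option of not being chosen. For
    noncrossing partitions no mere count is a sufficient state, since an arc disables every point
    below it, and how many depends on its start. After the advance choice only the number h of
    chosen points matters, because they must be used from the outermost inwards. *)

Section ArcSets.
Variables (T : finType) (lab : T -> int).
Hypothesis lab_inj : injective lab.
Implicit Types (A : {set T * T}) (P Q : {set {set T}}).

Definition arcset A : bool :=
  [&& [forall e in A, lab e.1 < lab e.2],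
      [forall e in A, forall f in A, (e.1 == f.1) ==> (e.2 == f.2)] &
      [forall e in A, forall f in A, (e.2 == f.2) ==> (e.1 == f.1)]].

Lemma arcsetP A :
  reflect [/\ forall a b, (a, b) \in A -> lab a < lab b,
              forall a b c, (a, b) \in A -> (a, c) \in A -> b = c &
              forall a b c, (a, c) \in A -> (b, c) \in A -> a = b]
          (arcset A).
Proof.
apply: (iffP and3P) => [[h1 h2 h3]|[h1 h2 h3]]; split.
- by move=> a b ab; apply: (forall_inP h1 (a, b)).
- move=> a b c ab ac.
  by have /implyP/(_ (eqxx a))/eqP := forall_inP (forall_inP h2 _ ab) _ ac.
- move=> a b c ab ac.
  by have /implyP/(_ (eqxx c))/eqP := forall_inP (forall_inP h3 _ ab) _ ac.
- by apply/forall_inP => -[a b]; apply: h1.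
- apply/forall_inP => -[a b] ab; apply/forall_inP => -[c d] cd.
  by apply/implyP => /= /eqP e; rewrite -e in cd; rewrite (h2 _ _ _ ab cd).
- apply/forall_inP => -[a b] ab; apply/forall_inP => -[c d] cd.
  by apply/implyP => /= /eqP e; rewrite -e in cd; rewrite (h3 _ _ _ ab cd).
Qed.

Definition has_out A a := [exists b, (a, b) \in A].
Definition has_in A a := [exists b, (b, a) \in A].

Lemma has_outP A a : reflect (exists b, (a, b) \in A) (has_out A a).
Proof. exact: existsP. Qed.

Lemma has_inP A a : reflect (exists b, (b, a) \in A) (has_in A a).
Proof. exact: existsP. Qed.

Lemma arcsE P a b : ((a, b) \in arcs lab P) = is_arc lab P a b.
Proof. by rewrite inE. Qed.

Lemma arcP P a b :
  reflect [/\ b \in pblock P a, lab a < lab b &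
             forall c, c \in pblock P a -> lab a < lab c -> lab b <= lab c]
          ((a, b) \in arcs lab P).
Proof.
rewrite arcsE; apply: (iffP and3P) => -[h1 h2 h3]; split=> //.
  move=> c hc ac; have := implyP (forallP h3 c) hc.
  by rewrite ac /= -leNgt.
apply/forallP => c; apply/implyP => hc; apply/negP => /andP[ac].
by rewrite ltNge (h3 c).
Qed.

Section SetPart.
Variable P : {set {set T}}.
Hypothesis partP : setpart P.

Let trivP : trivIset P. Proof. by case/and3P: partP. Qed.

Lemma pblock_refl a : a \in pblock P a.
Proof. by rewrite mem_pblock (cover_partition partP) inE. Qed.

Lemma pblock_eq a b : b \in pblock P a -> pblock P b = pblock P a.
Proof. exact: same_pblock. Qed.

Lemma pblock_sym a b : b \in pblock P a -> a \in pblock P b.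
Proof. by move=> /pblock_eq ->; apply: pblock_refl. Qed.

Lemma pblock_in a : pblock P a \in P.
Proof. by rewrite pblock_mem // (cover_partition partP) inE. Qed.

Lemma blockE B a : B \in P -> a \in B -> B = pblock P a.
Proof. by move=> hB aB; rewrite (def_pblock trivP hB). Qed.

Lemma arcs_arcset : arcset (arcs lab P).
Proof.
apply/arcsetP; split.
- by move=> a b /arcP[].
- move=> a b c /arcP[b1 b2 b3] /arcP[c1 c2 c3].
  by apply: lab_inj; apply: le_anti; rewrite b3 // c3.
- move=> a b c /arcP[a1 a2 a3] /arcP[b1 b2 b3]; apply: lab_inj.
  have ec : pblock P a = pblock P b by rewrite -(pblock_eq a1) (pblock_eq b1).
  have := pblock_refl a; have := pblock_refl b; rewrite {1}ec -{1}ec => hb ha.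
  apply: le_anti; rewrite !leNgt; apply/andP; split; apply/negP => h.
    by have := b3 a; rewrite -ec pblock_refl => /(_ isT h); lia.
  by have := a3 b; rewrite ec pblock_refl => /(_ isT h); lia.
Qed.

Lemma succ_exists u v : v \in pblock P u -> lab u < lab v ->
  exists2 w, (u, w) \in arcs lab P & lab w <= lab v.
Proof.
move=> uv luv.
pose D := [pred w | (w \in pblock P u) && (lab u < lab w)].
have Dv : D v by rewrite /= uv.
case: (arg_minP lab Dv) => w /andP[w1 w2] w3.
exists w; last exact: w3.
by apply/arcP; split=> // c c1 c2; apply: w3; rewrite /D /= c1.
Qed.

Lemma pred_exists u v : v \in pblock P u -> lab u < lab v ->
  exists w, (w, v) \in arcs lab P.
Proof.
move=> uv luv.
pose D := [pred w | (w \in pblock P u) && (lab w < lab v)].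
have Du : D u by rewrite /= pblock_refl.
case: (arg_maxP lab Du) => w /andP[w1 w2] w3.
exists w; have ew := pblock_eq w1; apply/arcP; split=> //; rewrite ew // => c c1 c2.
rewrite leNgt; apply/negP => c3.
by have := w3 c; rewrite /D /= c1 c3 => /(_ isT); lia.
Qed.

Lemma connect_pblock u v :
  connect (fun a b => (a, b) \in arcs lab P) u v -> v \in pblock P u.
Proof.
case/connectP => p; elim: p u => [|w p IH] u /=; first by move=> _ ->; apply: pblock_refl.
by case/andP => /arcP[w1 _ _] /IH h /h; rewrite (pblock_eq w1).
Qed.

(** Each arc leads to the next element of the block, so climbing from [u] cannot jump over [v]. The
    induction is on the gap between the labels, which every arc shortens. *)
Lemma pblock_connect u v : v \in pblock P u -> lab u <= lab v ->
  connect (fun a b => (a, b) \in arcs lab P) u v.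
Proof.
have [k] := ubnP `|lab v - lab u|%N; elim: k u => // k IH u hk uv.
rewrite le_eqVlt => /orP[/eqP /lab_inj -> //|luv].
have [w uw wv] := succ_exists uv luv.
apply: connect_trans (connect1 uw) _.
case/arcP: (uw) => w1 w2 _; apply: IH => //; first by lia.
by rewrite (pblock_eq w1).
Qed.

Lemma pblock_connectE u v : (v \in pblock P u) =
  connect (fun a b => (a, b) \in arcs lab P) u v ||
  connect (fun a b => (a, b) \in arcs lab P) v u.
Proof.
apply/idP/orP => [uv|[/connect_pblock //|/connect_pblock /pblock_sym //]].
case: (lerP (lab u) (lab v)) => [h|/ltW h]; first by left; apply: pblock_connect.
by right; apply: pblock_connect => //; apply: pblock_sym.
Qed.

Lemma feasibleE :
  feasible P = [forall t, has_in (arcs lab P) t || has_out (arcs lab P) t].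
Proof.
apply/forall_inP/forallP => [h t|h B BP].
  have /card_gt1P[a [b [at_ bt ab]]] := h _ (pblock_in t).
  have [c ct nct] : exists2 c, c \in pblock P t & c != t.
    by case: (eqVneq a t) => [ea|]; [exists b; rewrite // -ea eq_sym | exists a].
  case: (ltgtP (lab c) (lab t)) => [l|l|/lab_inj ec]; last by rewrite ec eqxx in nct.
    have [||w hw] := @pred_exists c t; rewrite ?(pblock_eq ct) ?pblock_refl //.
    by apply/orP; left; apply/has_inP; exists w.
  have [w hw _] := succ_exists ct l.
  by apply/orP; right; apply/has_outP; exists w.
have /set0Pn[t tB] : B != set0.
  by apply: contraTneq BP => ->; case/and3P: partP.
rewrite (blockE BP tB); apply/card_gt1P.
case/orP: (h t) => [/has_inP[c /arcP[c1 c2 _]]|/has_outP[c /arcP[c1 c2 _]]].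
  exists t, c; split; [exact: pblock_refl | exact: pblock_sym |].
  by apply: contraTneq c2 => ->; rewrite ltxx.
exists t, c; split; rewrite ?pblock_refl //.
by apply: contraTneq c2 => ->; rewrite ltxx.
Qed.

(** Of three points in a block, the middle one has neighbours on both sides. Subsets of a block are
    allowed so that this also applies to the nonzero part of a block. *)
Lemma middle_exists (B : {set T}) t : B \subset pblock P t -> (2 < #|B|)%N ->
  exists2 b, b \in B & has_in (arcs lab P) b && has_out (arcs lab P) b.
Proof.
move=> sB /card_gt2P[u [v [w [[uB vB wB] [uv vw wu]]]]].
have mid a b c : a \in B -> b \in B -> c \in B -> lab a < lab b -> lab b < lab c ->
    has_in (arcs lab P) b && has_out (arcs lab P) b.
  move=> /(subsetP sB) ha /(subsetP sB) hb /(subsetP sB) hc ab bc.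
  have [||d hd] := @pred_exists a b; rewrite ?(pblock_eq ha) //.
  have [||e he _] := @succ_exists b c; rewrite ?(pblock_eq hb) //.
  by apply/andP; split; [apply/has_inP; exists d|apply/has_outP; exists e].
have nl a b : a != b -> (lab a < lab b) || (lab b < lab a).
  by move=> ab; rewrite -neq_lt (inj_eq lab_inj).
case/orP: (nl _ _ uv) => h1; case/orP: (nl _ _ vw) => h2;
  case/orP: (nl _ _ wu) => h3.
- by have := lt_trans (lt_trans h1 h2) h3; rewrite ltxx.
- by exists v => //; apply: (mid u v w).
- by exists u => //; apply: (mid w u v).
- by exists w => //; apply: (mid u w v).
- by exists w => //; apply: (mid v w u).
- by exists u => //; apply: (mid v u w).
- by exists v => //; apply: (mid w v u).
- by have := lt_trans (lt_trans h3 h2) h1; rewrite ltxx.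
Qed.

Lemma poorE :
  poor P = [forall b, ~~ (has_in (arcs lab P) b && has_out (arcs lab P) b)].
Proof.
apply/forall_inP/forallP => [h b|h B BP].
  apply/negP => /andP[/has_inP[a /arcP[ab lab1 _]] /has_outP[c /arcP[bc lab2 _]]].
  have := h _ (pblock_in b); rewrite leqNgt => /negP; apply.
  apply/card_gt2P; exists a, b, c; rewrite pblock_refl bc (pblock_sym ab).
  by split=> //; split; apply/eqP => e; subst; lia.
have /set0Pn[t tB] : B != set0.
  by apply: contraTneq BP => ->; case/and3P: partP.
rewrite leqNgt; apply/negP => hB.
have sB : B \subset pblock P t by rewrite (blockE BP tB).
by have [b _ hb] := middle_exists sB hB; have := h b; rewrite hb.
Qed.

End SetPart.

Lemma arcs_inj P Q : setpart P -> setpart Q -> arcs lab P = arcs lab Q -> P = Q.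
Proof.
move=> hP hQ e.
rewrite -(equivalence_partition_pblock hP) -(equivalence_partition_pblock hQ).
have eb u : pblock P u = pblock Q u.
  by apply/setP => v; rewrite (pblock_connectE hP) (pblock_connectE hQ) e.
rewrite /equivalence_partition; apply: eq_imset => x.
by apply/setP => y; rewrite !inE eb.
Qed.

(** The blocks are the components of the undirected graph of [A]. With at most one arc out of and
    into each point, these components are increasing paths, and the arcs of a path join consecutive
    elements. *)
Lemma arcset_partition A : arcset A -> exists2 P, setpart P & arcs lab P = A.
Proof.
case/arcsetP => mono out1 in1.
pose e : rel T := fun a b => (a, b) \in A.
pose es : rel T := fun a b => e a b || e b a.
have conn_le a b : connect e a b -> lab a <= lab b.
  case/connectP => p; elim: p a => [|c p IH] a /=; first by move=> _ ->.
  by case/andP => /mono ac /IH h /h; lia.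
(* A path never needs to turn: where it changes direction, two arcs share an endpoint, so they
   coincide and cancel. *)
have connE a b : connect es a b -> connect e a b || connect e b a.
  case/connectP => p; elim: p a => [|c p IH] a /=; first by move=> _ ->; rewrite connect0.
  case/andP => ac /IH h /h {}h; case/orP: ac => ac; case/orP: h => h.
  - by rewrite (connect_trans (connect1 ac) h).
  - case/connectP: h => q; case/lastP: q => [|q z] /= hq eq.
      by rewrite -eq connect1.
    move: hq eq; rewrite rcons_path last_rcons => /andP[hq zl] eq.
    rewrite -{}eq in zl.
    rewrite (in1 _ _ _ ac zl); apply/orP; right.
    by apply/connectP; exists q.
  - case/connectP: h => -[|z q] /=; first by move=> _ ->; rewrite (connect1 ac) orbT.
    case/andP => cz hq eq; rewrite (out1 _ _ _ ac cz).
    by apply/orP; left; apply/connectP; exists q.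
  - by rewrite (connect_trans h (connect1 ac)) orbT.
have es_sym : connect_sym es by apply: sym_connect_sym => a b; rewrite /es orbC.
have eqv : {in [set: T] & &, equivalence_rel (connect es)}.
  apply/equivalence_relP_in/equivalence_relP_in => x y z _ _ _; split=> // xy.
  by apply: (same_connect es_sym).
have sub a b : connect e a b -> connect es a b.
  by apply: connect_sub => c d cd; apply: connect1; rewrite /es cd.
exists (equivalence_partition (connect es) [set: T]).
  exact: equivalence_partitionP.
have blkE a b : (b \in pblock (equivalence_partition (connect es) [set: T]) a)
                = connect es a b by apply: pblock_equivalence_partition; rewrite ?inE.
apply/setP => -[a b]; apply/arcP/idP => [[ab lt mn]|ab].
  have {}ab : connect e a b.
    by move: ab; rewrite blkE => /connE /orP[//|/conn_le]; lia.
  case/connectP: ab => -[|c p] /=; first by move=> _ eb; rewrite eb ltxx in lt.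
  case/andP => ac hp eb.
  have cb : connect e c b by apply/connectP; exists p.
  suff -> : b = c by [].
  apply: lab_inj; apply: le_anti; rewrite (conn_le _ _ cb) andbT.
  by apply: mn; [rewrite blkE; apply/sub/connect1 | apply: mono].
split; [by rewrite blkE; apply/sub/connect1 | exact: mono |].
move=> c; rewrite blkE => /connE /orP[|/conn_le]; last by lia.
case/connectP => -[|d p] /=; first by move=> _ ->; rewrite ltxx.
case/andP => ad hp ec _; rewrite (out1 _ _ _ ab ad).
by apply: conn_le; apply/connectP; exists p.
Qed.

Lemma sum_arcs (R : nmodType) (C : pred {set T * T}) (F : {set T * T} -> R) :
  \sum_(P | setpart P && C (arcs lab P)) F (arcs lab P) =
  \sum_(A | arcset A && C A) F A.
Proof.
(* The inverse of [arcs lab]; the default [set0] is reached only outside the arc sets, hence outside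
   the sum. *)
pose part_of A := odflt set0 [pick P | setpart P && (arcs lab P == A)].
have part_ofP A : arcset A -> setpart (part_of A) /\ arcs lab (part_of A) = A.
  move=> hA; rewrite /part_of; case: pickP => [P /andP[hP /eqP e] //|no].
  by have [P hP e] := arcset_partition hA; have := no P; rewrite hP e eqxx.
rewrite [RHS](reindex_onto (arcs lab) part_of); last first.
  by move=> A /andP[/part_ofP[]].
apply: eq_bigl => P; apply/idP/idP => [/andP[hP ->]|/andP[/andP[hA ->]]].
  have hA := arcs_arcset hP; rewrite hA /=; apply/eqP.
  by have [h1 h2] := part_ofP _ hA; apply: arcs_inj.
by have [h1 h2] := part_ofP _ hA; move=> /eqP <-; rewrite h1.
Qed.

End ArcSets.

(** * Iterates of linear operators *)

Section Iteration.
Variables (R : comNzRingType) (S : Type).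
Implicit Types (T : (S -> R) -> S -> R) (f g : S -> R).

(** Functions are compared pointwise only, so rewriting under an operator needs this compatibility
    as a separate fact. *)
Definition ext_op T := forall f g, f =1 g -> T f =1 T g.
Definition linear_op T :=
  forall c f g, T (fun s => f s + c * g s) =1 fun s => T f s + c * T g s.
Definition add_scalar T (c : R) f := fun s => T f s + c * f s.

Lemma add_scalar_ext T c : ext_op T -> ext_op (add_scalar T c).
Proof. by move=> hT f g e s; rewrite /add_scalar (hT _ _ e) e. Qed.

Lemma add_scalar_linear T c : linear_op T -> linear_op (add_scalar T c).
Proof. by move=> hT a f g s; rewrite /add_scalar hT; ring. Qed.

Lemma iter_ext T n : ext_op T -> ext_op (iter n T).
Proof. by move=> hT; elim: n => //= n IH f g e; apply/hT/IH. Qed.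

Lemma iter_linear T n : ext_op T -> linear_op T -> linear_op (iter n T).
Proof.
move=> hT lT; elim: n => //= n IH c f g s /=.
by rewrite (hT _ _ (IH c f g)) lT.
Qed.

Lemma eq_iter_op T T' n : ext_op T -> (forall f, T f =1 T' f) ->
  forall f, iter n T f =1 iter n T' f.
Proof.
move=> hT e f; elim: n => //= n IH s.
by rewrite (hT _ _ IH) e.
Qed.

Lemma iter_add_scalar T c n f s : ext_op T -> linear_op T ->
  iter n (add_scalar T c) f s =
  \sum_(k < n.+1) 'C(n, k)%:R * iter k T f s * c ^+ (n - k).
Proof.
move=> hT lT; elim: n f => [|n IH] f.
  by rewrite big_ord1 /= bin0 mul1r mulr1.
rewrite iterSr IH.
under eq_bigr => k _.
  rewrite (iter_linear k hT lT) -iterSr mulrDr mulrDl.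
  over.
rewrite big_split /= [RHS]big_ord_recl bin0.
under [in RHS]eq_bigr => k _ do
  rewrite lift0 binS addnC natrD mulrDl mulrDl subSS.
rewrite big_split /= addrCA; congr (_ + _).
pose u k := 'C(n, k)%:R * iter k T f s * c ^+ (n.+1 - k).
(* Pascal's rule leaves two sums; this vanishing term extends one of them to the common range. *)
have last0 : u n.+1 = 0 by rewrite /u bin_small // !mul0r.
transitivity (\sum_(k < n.+2) u k).
  rewrite [RHS]big_ord_recr /= last0 addr0; apply: eq_bigr => -[k hk] _.
  by rewrite /u /= subSn // exprS; ring.
by rewrite big_ord_recl; congr (_ + _); rewrite /u bin0.
Qed.

End Iteration.

(** * Operators for all partitions *)

Section BlockOperators.
Variable R : comNzRingType.
Implicit Types (x c : R) (d : nat).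

(* [d] is the number of points added at each level: [d = 1] for partitions of
   [n], [d = 2] for symmetric ones. *)
Definition block_op d x (g : nat -> R) (b : nat) := g (b + d)%N + b%:R * x * g b.

(** The three terms: the new point stays a singleton; an arc starts at a non-singleton, which the
    new point replaces; an arc starts at one of the [d * p.1] singletons. For [d = 2], [p.1] counts
    mirror pairs, and in the third term the mirror image of the start joins the others together with
    the new point. *)
Definition singleton_op d x (f : nat * nat -> R) (p : nat * nat) :=
  f (p.1.+1, p.2) + p.2%:R * x * f p + (d * p.1)%:R * x * f (p.1.-1, (p.2 + d)%N).

Lemma block_op_ext d x : ext_op (block_op d x).
Proof. by move=> f g e b; rewrite /block_op !e. Qed.

Lemma block_op_linear d x : linear_op (block_op d x).
Proof. by move=> c f g b; rewrite /block_op; ring. Qed.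

Lemma singleton_op_ext d x : ext_op (singleton_op d x).
Proof. by move=> f g e b; rewrite /singleton_op !e. Qed.

Lemma singleton_op_linear d x : linear_op (singleton_op d x).
Proof. by move=> c f g b; rewrite /singleton_op; ring. Qed.

(** [d * p.1 + p.2] counts all points that start no arc, so test functions of this form forget which
    of them are singletons. *)
Lemma singleton_block_op d x c n (g : nat -> R) p :
  iter n (add_scalar (singleton_op d x) c) (fun p => g (d * p.1 + p.2)%N) p =
  iter n (add_scalar (block_op d x) c) g (d * p.1 + p.2)%N.
Proof.
elim: n p => //= n IH [s r]; rewrite /add_scalar /singleton_op /block_op /= in IH *.
rewrite !IH /= mulnSr.
case: s => [|s] /=; rewrite ?muln0 ?add0n.
  by rewrite mul0r mul0r addr0 addnC.
have -> : (d * s.+1 + d + r = d * s.+1 + r + d)%N by lia.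
have -> : (d * s + (r + d) = d * s.+1 + r)%N by lia.
by rewrite [in RHS]natrD; ring.
Qed.

(** Steps of 2 preserve even states, and 2b choices of weight x amount to b choices of weight 2x. *)
Lemma block_op_double x c n (b : nat) :
  iter n (add_scalar (block_op 2 x) c) (fun _ => 1) (2 * b)%N =
  iter n (add_scalar (block_op 1 (2 * x)) c) (fun _ => 1) b.
Proof.
elim: n b => //= n IH b; rewrite /add_scalar /block_op /= in IH *.
have -> : (2 * b + 2 = 2 * (b + 1))%N by lia.
by rewrite !IH natrM; ring.
Qed.

(** Passing from [b.+1] to [b] leaves out the largest point, whose arc weighs [y] instead of [x]. *)
Lemma block_op_shift x y n (b : nat) (T : (nat -> R) -> nat -> R) :
  (forall g b, T g b.+1 = g (b.+1 + 2)%N + (y + b%:R * x) * g b.+1) ->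
  iter n T (fun _ => 1) b.+1 = iter n (add_scalar (block_op 2 x) y) (fun _ => 1) b.
Proof.
move=> hT; elim: n b => //= n IH b.
by rewrite hT /add_scalar /block_op addSn !IH /=; ring.
Qed.

(* The binomial transform [\sum_j 'C(s, j) * g j]. *)
Fixpoint binom_transform (g : nat -> R) (s : nat) : R :=
  if s is s'.+1 then binom_transform g s' + binom_transform (fun j => g j.+1) s'
  else g 0.

Lemma binom_transform_ext g h : g =1 h -> binom_transform g =1 binom_transform h.
Proof.
move=> e s; elim: s g h e => [|s IH] g h e /=; first exact: e.
by congr (_ + _); apply: IH => // j; apply: e.
Qed.

Lemma binom_transform_linear c g h s :
  binom_transform (fun j => g j + c * h j) s =
  binom_transform g s + c * binom_transform h s.
Proof.
elim: s g h => [|s IH] g h //=.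
by rewrite IH (IH (fun j => g j.+1) (fun j => h j.+1)); ring.
Qed.

(** The absorption identity j C(s, j) = s C(s-1, j-1). *)
Lemma binom_transform_mul g s :
  binom_transform (fun j => j%:R * g j.-1) s = s%:R * binom_transform g s.-1.
Proof.
elim: s g => [|s IH] g; first by rewrite /= !mul0r.
rewrite /= IH.
rewrite (@binom_transform_ext (fun j => j.+1%:R * g j)
  (fun j => g j + 1 * (j%:R * g j.-1.+1))); last first.
  case=> [|j] /=; first by rewrite mul0r mulr0 addr0 mul1r.
  by rewrite -[j.+2%:R]natr1 mulrDl !mul1r addrC.
rewrite binom_transform_linear (IH (fun j => g j.+1)).
case: s {IH} => [|s] /=; first by ring.
ring.
Qed.

(* [binom_transform] in the singleton variable conjugates [singleton_op] to
   [singleton_op] plus the identity. *)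
Lemma singleton_op_transform d x c n r :
  iter n (add_scalar (singleton_op d x) c) (fun _ => 1) (0%N, r) =
  iter n (add_scalar (singleton_op d x) (c + 1)) (fun p => (p.1 == 0%N)%:R) (0%N, r).
Proof.
pose Z (f : nat * nat -> R) (p : nat * nat) := binom_transform (fun j => f (j, p.2)) p.1.
have Zdelta p : Z (fun p => (p.1 == 0%N)%:R) p = 1.
  case: p => s r'; rewrite /Z /=; elim: s => //= s ->.
  have -> : forall u, binom_transform (fun j => (j.+1 == 0%N)%:R) u = 0.
    by elim=> //= u IH; rewrite IH addr0.
  by rewrite addr0.
(* The extra identity arises from the first term alone: by Pascal's rule, Z f at s+1 is Z f at s
   plus Z of the shifted f at s. *)
have comm f p : add_scalar (singleton_op d x) c (Z f) p =
                Z (add_scalar (singleton_op d x) (c + 1) f) p.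
  case: p => s r'; rewrite /add_scalar /singleton_op /Z /=.
  rewrite [RHS](@binom_transform_ext _ (fun j => f (j.+1, r') + (r'%:R * x + c + 1) * f (j, r')
    + (d%:R * x) * (j%:R * f (j.-1, r' + d)%N))); last first.
    by move=> j; rewrite /= natrM; ring.
  rewrite !binom_transform_linear.
  by rewrite (binom_transform_mul (fun j => f (j, (r' + d)%N))) natrM; ring.
have iterZ f p : iter n (add_scalar (singleton_op d x) c) (Z f) p =
                 Z (iter n (add_scalar (singleton_op d x) (c + 1)) f) p.
  elim: n p => // n IH p; rewrite !iterS -comm.
  exact: (add_scalar_ext _ (@singleton_op_ext d x) IH).
(* At zero singletons [Z] is plain evaluation, so it may be put in front. *)
rewrite -[RHS]/(Z _ (0%N, r)) -iterZ.
apply: (iter_ext _ (add_scalar_ext _ (@singleton_op_ext d x))).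
by move=> p; rewrite Zdelta.
Qed.

End BlockOperators.

(** * Operators for noncrossing partitions *)

Section PathOperators.
Variables (R : comNzRingType) (x : R).
Implicit Types (c y : R) (f g : nat -> R).

(* Steps of two-sided lattice paths, seen through the distance to the axis: an
   up step weighs [1], a down step [x], and from the axis there are two ways up. *)
Definition fold_op f (h : nat) := f h.+1 + (if h is h'.+1 then x * f h' else f 1%N).

Definition delta0 (h : nat) : R := (h == 0%N)%:R.

Lemma fold_op_ext : ext_op fold_op.
Proof. by move=> f g e [|h]; rewrite /fold_op !e. Qed.

Lemma fold_op_linear : linear_op fold_op.
Proof. by move=> c f g [|h]; rewrite /fold_op; ring. Qed.

(** Unfolded, these are the k-step paths on the integers from h to 0. There are C(k, (k+h)/2) of
    them, and each has (k+h)/2 steps towards the axis, the ones that weigh x. *)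
Lemma iter_fold_op k h : iter k fold_op delta0 h =
  if odd (k + h) then 0 else 'C(k, (k + h)./2)%:R * x ^+ (k + h)./2.
Proof.
elim: k h => [|k IH] h.
  rewrite /= add0n /delta0; case: h => [|[|h]] //=; first by rewrite mulr1.
  by case: ifP => // _; rewrite mul0r.
case: h => [|h]; rewrite iterS {1}/fold_op !IH; last first.
  rewrite addSn !addnS /= !negbK; case: ifP => ho; first by rewrite mulr0 addr0.
  by rewrite binS natrD exprS; ring.
rewrite addn0 addn1 /=; case: ifP => ho; first by rewrite addr0.
(* From the axis both ways up give C(2j+1, j+1); by symmetry one of them is C(2j+1, j), and Pascal's
   rule applies. *)
have [j ej] : exists j, k = j.*2.+1.
  by exists k./2; have := odd_double_half k; move: ho; case: (odd k) => //= _; lia.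
rewrite {}ej /= doubleK [in RHS]binS natrD.
have -> : 'C(j.*2.+1, j) = 'C(j.*2.+1, j.+1).
  by rewrite -[LHS]bin_sub; [congr 'C(_, _); lia | lia].
by ring.
Qed.

Lemma iter_fold_op_scalar c n h :
  iter n (add_scalar fold_op c) delta0 h =
  \sum_(k < n.+1) 'C(n, k)%:R * iter k fold_op delta0 h * c ^+ (n - k).
Proof. exact: iter_add_scalar fold_op_ext fold_op_linear. Qed.

Lemma iter_fold_op0 c n :
  iter n (add_scalar fold_op c) delta0 0%N =
  \sum_(k < n.+1) 'C(2 * k, k)%:R * 'C(n, 2 * k)%:R * x ^+ k * c ^+ (n - 2 * k).
Proof.
rewrite iter_fold_op_scalar.
pose u k := 'C(n, k)%:R * iter k fold_op delta0 0%N * c ^+ (n - k).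
(* The range is doubled by terms with vanishing binomials, so that it splits into pairs 2k, 2k+1;
   paths of odd length do not return to the axis. *)
have -> : \sum_(k < n.+1) 'C(n, k)%:R * iter k fold_op delta0 0%N * c ^+ (n - k) =
          \sum_(k < 2 * n.+1) u k.
  rewrite (big_ord_widen (2 * n.+1) u); last by lia.
  rewrite big_mkcond; apply: eq_bigr => k _; rewrite /u; case: ltnP => // hk.
  by rewrite bin_small // !mul0r.
have -> : \sum_(k < 2 * n.+1) u k = \sum_(k < n.+1) (u (2 * k)%N + u (2 * k).+1).
  elim: n.+1 => [|m IH]; first by rewrite !big_ord0.
  have -> : (2 * m.+1 = (2 * m).+2)%N by lia.
  by rewrite !big_ord_recr /= IH addrA.
apply: eq_bigr => k _; rewrite /u !iter_fold_op !addn0 /= mul2n odd_double /=.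
by rewrite mulr0 mul0r addr0 doubleK; ring.
Qed.

(** The parity of k decides which of the two heights contributes: 0 for even k, 1 for odd k. The
    symmetry of binomials then gives a common formula. *)
Lemma iter_fold_op01 c n :
  iter n (add_scalar fold_op c) delta0 0%N + iter n (add_scalar fold_op c) delta0 1%N =
  \sum_(k < n.+1) 'C(n, k)%:R * 'C(k, k./2)%:R * x ^+ (uphalf k) * c ^+ (n - k).
Proof.
rewrite !iter_fold_op_scalar -big_split; apply: eq_bigr => -[k hk] _ /=.
rewrite !iter_fold_op addn0 addn1 /=; case: ifP => ho /=; last first.
  by rewrite uphalf_half ho; ring.
suff -> : 'C(k, uphalf k) = 'C(k, k./2) by ring.
have := odd_double_half k; rewrite ho => ek.
by rewrite -[LHS]bin_sub ?uphalf_half ho; [congr 'C(_, _) | ]; lia.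
Qed.

Definition down_op f (h : nat) := if h is h'.+1 then x * f h' else 0.

(* A word lists the signs of the points that a new outer arc may still reach,
   outermost first.  [psi g w] sums [g #|D|] over the sets [D] of these points
   that can all be used by later arcs: choosing a nonnegative point keeps the
   points after it in the list, choosing a negative one discards everything. *)
Fixpoint psi g (w : seq bool) : R :=
  match w with
  | [::] => g 0%N
  | true :: w' => psi g w' + psi (fun h => g h.+1) w'
  | false :: w' => psi g w' + g 1%N
  end.

Lemma psi_ext g h w : g =1 h -> psi g w = psi h w.
Proof.
elim: w g h => [|[] w IH] g h e /=; first exact: e.
  by congr (_ + _); apply: IH => // j; apply: e.
by rewrite (IH _ _ e) e.
Qed.

Lemma psi_linear c g h w :
  psi (fun j => g j + c * h j) w = psi g w + c * psi h w.
Proof.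
elim: w g h => [|[] w IH] g h //=.
  by rewrite IH (IH (fun j => g j.+1) (fun j => h j.+1)); ring.
by rewrite IH; ring.
Qed.

(** Only the empty choice is counted. Hence [delta0] as test function recovers the plain generating
    function. *)
Lemma psi_delta0 w : psi delta0 w = 1.
Proof.
elim: w => [|b w IH] //=; rewrite IH.
have psi0 g u : g =1 (fun _ => 0) -> psi g u = 0.
  elim: u g => [|[] u IHu] g e //=; last by rewrite IHu // e addr0.
  by rewrite !IHu ?addr0 // => h; apply: e.
by rewrite psi0 // addr0; case: b; rewrite // /delta0 addr0.
Qed.

(** Of the two points put in front, choosing neither gives the scalar 1, choosing the positive one
    gives the up step, and choosing the negative one gives [f 1]. The latter is independent of [w],
    so it is attached to the empty choice: it is the second way up from the axis. *)
Lemma psi_fold_op y f w :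
  psi (add_scalar fold_op (1 + y) f) w =
  psi f [:: false, true & w] + y * psi f w + psi (down_op f) w.
Proof.
rewrite (@psi_ext _ (fun h => (f h.+1 + 1 * down_op f h) + (1 + y) * f h + f 1%N * delta0 h)).
  rewrite !psi_linear psi_delta0 /=; ring.
by case=> [|h]; rewrite /add_scalar /fold_op /down_op /delta0 /=; ring.
Qed.

(** A nonempty choice is sorted by its first, outermost element [a]; the rest of it is a choice
    among the points after [a]. Using [a] for an arc lowers the size by one, which is the down
    step. *)
Lemma psi_choice (T : eqType) (aft : rel T) (s : pred T) f (L : seq T) :
  irreflexive aft -> (forall a b, aft a b -> s a) ->
  pairwise (fun a b => ~~ aft b a && (s a ==> aft a b)) L ->
  x * (\sum_(a <- L) psi f (map s (filter (aft a) L))) = psi (down_op f) (map s L).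
Proof.
move=> irr sgn; elim: L => [|a L IH] /=; first by rewrite big_nil mulr0.
case/andP => /allP haL /IH {}IH; rewrite big_cons irr mulrDr.
rewrite (eq_big_seq (fun j => psi f [seq s i | i <- L & aft j i])); last first.
  by move=> j /haL /andP[/negbTE -> _].
(* A nonnegative head keeps the whole tail, a negative one nothing, in agreement with the two
   clauses of [psi]. *)
rewrite IH; case sa: (s a) haL => haL.
  have -> : [seq x0 <- L | aft a x0] = L.
    by apply/all_filterP/allP => c /haL /andP[_].
  rewrite addrC; congr (_ + _).
  rewrite -[x * _]add0r -[0](_ : psi (fun _ => 0) (map s L) = 0); last first.
    by elim: (map s L) => [|[] w IHw] //=; rewrite IHw addr0.
  by rewrite -psi_linear; apply: psi_ext => h; rewrite add0r.
have -> : [seq x0 <- L | aft a x0] = [::].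
  rewrite (@eq_filter _ _ pred0) ?filter_pred0 // => c.
  by apply/negP => /sgn; rewrite sa.
by rewrite addrC.
Qed.

End PathOperators.

(** * Symmetric arc sets *)

Section Mirror.
Variables (T : finType) (lab : T -> int) (neg : T -> T).
Hypothesis lab_inj : injective lab.
Hypothesis lab_neg : forall t, lab (neg t) = - lab t.
Implicit Types (A : {set T * T}) (a b c d t : T) (m : nat).

Lemma eq_lab a b : (a == b) = (lab a == lab b).
Proof. by rewrite (inj_eq lab_inj). Qed.

Lemma mirrorK : involutive neg.
Proof. by move=> t; apply: lab_inj; rewrite !lab_neg opprK. Qed.

Definition symarcs A : bool :=
  [&& arcset lab A,
      [forall a, forall b, ((a, b) \in A) == ((neg b, neg a) \in A)] &
      [forall a, (neg a, a) \notin A]].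

Definition within m t : bool := - m%:Z <= lab t <= m%:Z.

(** All levels live on the same type [T], so raising the level is a union of sets and needs no
    change of labels. *)
Definition valid m A : bool :=
  symarcs A && [forall e in A, within m e.1 && within m e.2].

Lemma validP m A :
  reflect ([/\ forall a b, (a, b) \in A -> lab a < lab b,
               forall a b c, (a, b) \in A -> (a, c) \in A -> b = c &
               forall a b c, (a, c) \in A -> (b, c) \in A -> a = b] /\
           [/\ forall a b, ((a, b) \in A) = ((neg b, neg a) \in A),
               forall a, (neg a, a) \notin A &
               forall a b, (a, b) \in A -> within m a && within m b])
          (valid m A).
Proof.
apply: (iffP andP) => [[/and3P[/arcsetP h1 h2 h3] h4]|[h1 [h2 h3 h4]]]; split=> //.
- split=> [a b|a|a b ab]; last exact: (forall_inP h4 (a, b)).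
    by apply/eqP; have /forallP/(_ b) := forallP h2 a.
  exact: forallP h3 a.
- apply/and3P; split; first exact/arcsetP.
    by apply/forallP => a; apply/forallP => b; rewrite -h2.
  exact/forallP.
- by apply/forall_inP => -[a b]; apply: h4.
Qed.

Lemma has_in_neg m A t : valid m A -> has_in A t = has_out A (neg t).
Proof.
case/validP => _ [mir _ _].
apply/has_inP/has_outP => -[a at_]; exists (neg a); first by rewrite -mir.
by rewrite mir mirrorK.
Qed.

Lemma has_out_within m A t : valid m A -> has_out A t -> (within m t) && (lab t < m%:Z).
Proof.
case/validP => -[mono _ _] [_ _ bnd] /has_outP[b tb].
by have := mono _ _ tb; have := bnd _ _ tb; rewrite /within; lia.
Qed.

Definition covered A t : bool := [exists e in A, lab e.1 < lab t < lab e.2].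

Lemma coveredP A t :
  reflect (exists c d, (c, d) \in A /\ lab c < lab t < lab d) (covered A t).
Proof.
apply: (iffP exists_inP) => [[[c d] cd h]|[c [d [cd h]]]]; first by exists c, d.
by exists (c, d).
Qed.

Lemma covered_neg m A t : valid m A -> covered A (neg t) = covered A t.
Proof.
case/validP => _ [mir _ _].
apply/coveredP/coveredP => -[c [d [cd h]]]; exists (neg d), (neg c);
  by rewrite -mir; split=> //; move: h; rewrite !lab_neg; lia.
Qed.

Lemma covered_within m A t : valid m A -> covered A t -> within m t.
Proof.
case/validP => _ [_ _ bnd] /coveredP[c [d [/bnd]]].
by rewrite /within; lia.
Qed.

Definition avail m A : {set T} := [set t | within m t && ~~ has_out A t].

Definition covset A : {set T * T} := [set e in A | lab e.2 == lab e.1 + 1].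

Definition weight (R : comNzRingType) (x y : R) A : R :=
  x ^+ (#|A :\: covset A| %/ 2) * y ^+ (#|covset A| %/ 2).

(** The base level. Between points labelled m and -m the only increasing pair would be its own
    mirror image, which is excluded. *)
Lemma valid_noarc m A : (forall t, within m t -> `|lab t|%N = m) ->
  valid m A = (A == set0).
Proof.
move=> h; apply/idP/eqP => [/validP[[mono _ _] [_ ns bnd]]|->].
  apply/eqP; rewrite -subset0; apply/subsetP => -[a b] ab.
  have := mono _ _ ab; have /andP[/h ha /h hb] := bnd _ _ ab => lt.
  have e : a = neg b by apply: lab_inj; rewrite lab_neg; lia.
  by have := ns b; rewrite -e ab.
apply/validP; split; split.
- by move=> a b; rewrite inE.
- by move=> a b c; rewrite inE.
- by move=> a b c; rewrite inE.
- by move=> a b; rewrite !inE.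
- by move=> a; rewrite inE.
- by move=> a b; rewrite inE.
Qed.

(** * Raising the level of a symmetric arc set by one *)

Section Insertion.
Variables (m : nat) (p : T).
Hypothesis lab_p : lab p = m.+1%:Z.

Definition outer_arcs a : {set T * T} := [set (a, p); (neg p, neg a)].
Definition insert A a := A :|: outer_arcs a.

Lemma within_succ t : within m.+1 t = [|| t == p, t == neg p | within m t].
Proof. by rewrite !eq_lab lab_neg lab_p /within; lia. Qed.

Lemma insertE A a c d : ((c, d) \in insert A a) =
  [|| (c, d) \in A, (c == a) && (d == p) | (c == neg p) && (d == neg a)].
Proof. by rewrite !inE !xpair_eqE. Qed.

Lemma has_out_insert A a t : has_out (insert A a) t =
  [|| has_out A t, t == a | t == neg p].
Proof.
apply/has_outP/or3P => [[d]|[/has_outP[d td]|/eqP->|/eqP->]].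
- rewrite insertE => /or3P[h|/andP[h _]|/andP[h _]].
  + by constructor 1; apply/has_outP; exists d.
  + by constructor 2.
  + by constructor 3.
- by exists d; rewrite insertE td.
- by exists p; rewrite insertE !eqxx orbT.
- by exists (neg a); rewrite insertE !eqxx !orbT.
Qed.

Lemma has_in_insert A a t : has_in (insert A a) t =
  [|| has_in A t, t == p | t == neg a].
Proof.
apply/has_inP/or3P => [[d]|[/has_inP[d td]|/eqP->|/eqP->]].
- rewrite insertE => /or3P[h|/andP[_ h]|/andP[_ h]].
  + by constructor 1; apply/has_inP; exists d.
  + by constructor 2.
  + by constructor 3.
- by exists d; rewrite insertE td.
- by exists a; rewrite insertE !eqxx orbT.
- by exists (neg p); rewrite insertE !eqxx !orbT.
Qed.

Lemma covered_insert A a t : covered (insert A a) t =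
  [|| covered A t, lab a < lab t < lab p | - lab p < lab t < - lab a].
Proof.
apply/coveredP/or3P => [[c [d []]]|[/coveredP[c [d [cd h]]]|h|h]].
- rewrite insertE => /or3P[h|/andP[/eqP-> /eqP->]|/andP[/eqP-> /eqP->]] h'.
  + by constructor 1; apply/coveredP; exists c, d.
  + by constructor 2.
  + by constructor 3; rewrite -!lab_neg.
- by exists c, d; rewrite insertE cd.
- by exists a, p; rewrite insertE !eqxx orbT.
- by exists (neg p), (neg a); rewrite insertE !eqxx !orbT !lab_neg.
Qed.

Lemma outer_arcs_notin A a e : valid m A -> e \in A -> e \in outer_arcs a = false.
Proof.
case/validP => _ [_ _ bnd]; case: e => c d /bnd h.
rewrite !inE !xpair_eqE !eq_lab !lab_neg lab_p; move: h; rewrite /within; lia.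
Qed.

(** Stated in the shape that [reindex_onto] asks for: inserting and deleting the outer arcs at [a]
    are inverse to each other. *)
Lemma insert_valid A a :
  valid m.+1 (insert A a) && (insert A a :\: outer_arcs a == A) =
  valid m A && (a \in avail m A).
Proof.
have lp := lab_p; rewrite inE.
apply/andP/andP => [[/validP[[mono out1 in1] [mir ns bnd]] /eqP eA]|[vA /andP[wa oa]]].
  have sub c d : (c, d) \in A -> (c, d) \in insert A a by rewrite insertE => ->.
  have dis c d : (c, d) \in A -> (c, d) \notin outer_arcs a.
    by rewrite -{1}eA inE => /andP[].
  have ap : (a, p) \in insert A a by rewrite insertE !eqxx orbT.
  have pa : (neg p, neg a) \in insert A a by rewrite insertE !eqxx !orbT.
  have dap c d : (c, d) \in A -> ((c, d) != (a, p)) && ((c, d) != (neg p, neg a)).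
    by move=> /dis; rewrite !inE negb_or.
  split.
    apply/validP; split; split.
    - by move=> c d /sub /mono.
    - by move=> c d e /sub cd /sub /(out1 _ _ _ cd).
    - by move=> c d e /sub cd /sub /(in1 _ _ _ cd).
    - move=> c d; apply/idP/idP => h.
        have := h => /sub; rewrite mir insertE => /or3P[//||] /andP[/eqP h1 /eqP h2].
          have /andP[_] := dap _ _ h; rewrite xpair_eqE.
          by rewrite -h2 -h1 !mirrorK !eqxx.
        have /andP[] := dap _ _ h; rewrite xpair_eqE.
        by rewrite -(mirrorK c) h2 mirrorK -(mirrorK d) h1 mirrorK !eqxx.
      have := h => /sub; rewrite -mir insertE => /or3P[//||] /andP[/eqP h1 /eqP h2].
        by have /andP[_] := dap _ _ h; rewrite xpair_eqE h1 h2 !eqxx.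
      by have /andP[] := dap _ _ h; rewrite xpair_eqE h1 h2 !mirrorK !eqxx.
    - by move=> c; apply: contra (ns c); apply: sub.
    - move=> c d h; have := bnd _ _ (sub _ _ h); have := mono _ _ (sub _ _ h).
      have /andP[n1 n2] := dap _ _ h.
      (* Once the arc into [p] and its mirror are gone, uniqueness of ends and starts leaves no arc
         at [p] or [neg p], so the level drops. *)
      have n3 : lab d != lab p.
        apply: contraNneq n1 => /lab_inj ed; rewrite ed in h *.
        by rewrite (in1 _ _ _ (sub _ _ h) ap).
      have n4 : lab c != - lab p.
        rewrite -lab_neg; apply: contraNneq n2 => /lab_inj ed; rewrite ed in h *.
        by rewrite (out1 _ _ _ (sub _ _ h) pa).
      by move: n3 n4; rewrite /within lp; lia.
  apply/andP; split.
    have := bnd _ _ ap; have := mono _ _ ap.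
    have : lab a != - lab p.
      by rewrite -lab_neg -eq_lab; apply: contraNneq (ns p) => <-.
    by rewrite /within lp; lia.
  apply/negP => /has_outP[d h].
  by have /andP[/negP] := dap _ _ h; rewrite (out1 _ _ _ (sub _ _ h) ap) eqxx.
have [[mono out1 in1] [mir ns bnd]] := validP _ _ vA.
split; last first.
  apply/eqP/setP => e; rewrite in_setD [e \in insert A a]in_setU.
  case: (boolP (e \in A)) => [h|_]; first by rewrite (outer_arcs_notin a vA h).
  by rewrite /= andNb.
have noout d : (a, d) \notin A by apply: contra oa => h; apply/has_outP; exists d.
have noin d : (d, neg a) \notin A by rewrite mir mirrorK.
have wa' := wa; rewrite /within in wa'.
have np d : (d, p) \notin A.
  by apply/negP => /bnd; rewrite /within lp; lia.
have np' d : (neg p, d) \notin A by rewrite mir mirrorK.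
have anp : a != neg p by rewrite eq_lab lab_neg; lia.
have anp' : neg a != p by rewrite eq_lab lab_neg; lia.
apply/validP; split; split.
- move=> c d; rewrite insertE => /or3P[/mono //||] /andP[/eqP-> /eqP->];
    by rewrite ?lab_neg lp; lia.
- move=> c d e; rewrite !insertE => /or3P[h1|/andP[/eqP h1 /eqP k1]|/andP[/eqP h1 /eqP k1]]
    /or3P[h2|/andP[/eqP h2 /eqP k2]|/andP[/eqP h2 /eqP k2]].
  + exact: out1 h1 h2.
  + by rewrite h2 (negbTE (noout _)) in h1.
  + by rewrite h2 (negbTE (np' _)) in h1.
  + by rewrite h1 (negbTE (noout _)) in h2.
  + by rewrite k1 k2.
  + by move: anp; rewrite -h1 h2 eqxx.
  + by rewrite h1 (negbTE (np' _)) in h2.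
  + by move: anp; rewrite -h2 h1 eqxx.
  + by rewrite k1 k2.
- move=> c d e; rewrite !insertE => /or3P[h1|/andP[/eqP h1 /eqP k1]|/andP[/eqP h1 /eqP k1]]
    /or3P[h2|/andP[/eqP h2 /eqP k2]|/andP[/eqP h2 /eqP k2]].
  + exact: in1 h1 h2.
  + by rewrite k2 (negbTE (np _)) in h1.
  + by rewrite k2 (negbTE (noin _)) in h1.
  + by rewrite k1 (negbTE (np _)) in h2.
  + by rewrite h1 h2.
  + by move: anp'; rewrite -k2 k1 eqxx.
  + by rewrite k1 (negbTE (noin _)) in h2.
  + by move: anp'; rewrite -k1 k2 eqxx.
  + by rewrite h1 h2.
- move=> c d; rewrite !insertE -mir; congr (_ || _).
  rewrite !(inj_eq (can_inj mirrorK)) orbC; congr (_ || _).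
    by rewrite andbC -(inj_eq (can_inj mirrorK) c) -(inj_eq (can_inj mirrorK) d) !mirrorK.
  by rewrite andbC.
- move=> c; rewrite insertE negb_or ns /=; apply/negP => /orP[] /andP[/eqP h1 /eqP h2].
    by move: anp; rewrite -h2 h1 eqxx.
  by move: anp'; rewrite -h2 -(mirrorK p) -h1 mirrorK eqxx.
- move=> c d; rewrite insertE => /or3P[/bnd||].
  + by rewrite /within; lia.
  + by move=> /andP[/eqP-> /eqP->]; rewrite /within ?lab_neg lp; lia.
  + by move=> /andP[/eqP-> /eqP->]; rewrite /within ?lab_neg lp; lia.
Qed.

Lemma valid_noin A : valid m.+1 A && ~~ has_in A p = valid m A.
Proof.
have lp := lab_p; apply/andP/idP => [[vA ni]|vA].
  have [h1 [mir ns bnd]] := validP _ _ vA; have [mono _ _] := h1.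
  apply/validP; split=> //; split=> // c d cd.
  have n1 : lab d != lab p.
    by apply: contraNneq ni => /lab_inj e; apply/has_inP; exists c; rewrite -e.
  have n2 : lab c != - lab p.
    rewrite -lab_neg; apply: contraNneq ni => /lab_inj e; apply/has_inP.
    by exists (neg d); rewrite -[p]mirrorK -mir -e.
  by have := bnd _ _ cd; have := mono _ _ cd; move: n1 n2; rewrite /within lp; lia.
have [h1 [mir ns bnd]] := validP _ _ vA; split.
  apply/validP; split=> //; split=> // c d /bnd; rewrite /within; lia.
by apply/negP => /has_inP[c /bnd]; rewrite /within lp; lia.
Qed.

Lemma sum_insert (V : nmodType) (F : {set T * T} -> V) :
  \sum_(A | valid m.+1 A) F A =
  \sum_(A | valid m A) (F A + \sum_(a in avail m A) F (insert A a)).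
Proof.
rewrite (bigID (fun A => has_in A p)) /= addrC big_split /=; congr (_ + _).
  by apply: eq_bigl => A; rewrite valid_noin.
(* The inner sum has one term if an arc ends in [p] and none otherwise, so it replaces the
   condition. *)
transitivity (\sum_(A | valid m.+1 A) \sum_(a | (a, p) \in A) F A).
  rewrite big_mkcondr; apply: eq_bigr => A /validP[[_ _ in1] _].
  case: (boolP (has_in A p)) => [/has_inP[a ap]|/has_inP no].
    rewrite (big_pred1 a) // => b; apply/idP/eqP => [bp|-> //].
    exact: in1 bp ap.
  by rewrite big_pred0 // => a; apply/negP => ap; apply: no; exists a.
rewrite (exchange_big_dep predT) //= [RHS](exchange_big_dep predT) //=.
apply: eq_bigr => a _.
rewrite (reindex_onto (fun B => insert B a) (fun A => A :\: outer_arcs a)) /=; last first.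
  move=> A /andP[/validP[_ [mir _ _]] ap]; rewrite /insert.
  apply/setP => e; rewrite !inE; case: (boolP (e == (a, p))) => [/eqP->|_] /=.
    by rewrite ap.
  case: (boolP (e == (neg p, neg a))) => [/eqP->|_] /=; last by rewrite orbF.
  by rewrite -mir ap.
apply: eq_bigl => B; rewrite -insert_valid.
by rewrite insertE !eqxx orbT andbT.
Qed.

Lemma within_p : within m p = false.
Proof. by rewrite /within lab_p; lia. Qed.

Lemma within_np : within m (neg p) = false.
Proof. by rewrite /within lab_neg lab_p; lia. Qed.

Lemma out_p A : valid m A -> has_out A p = false.
Proof.
by move=> vA; apply/negbTE/negP => h; have := has_out_within vA h; rewrite within_p.
Qed.

Lemma out_np A : valid m A -> has_out A (neg p) = false.
Proof.
by move=> vA; apply/negbTE/negP => h; have := has_out_within vA h; rewrite within_np.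
Qed.

Lemma in_p A : valid m A -> has_in A p = false.
Proof. by move=> vA; rewrite (has_in_neg _ vA) out_np. Qed.

Lemma in_np A : valid m A -> has_in A (neg p) = false.
Proof. by move=> vA; rewrite (has_in_neg _ vA) mirrorK out_p. Qed.

Lemma covered_p A : valid m A -> covered A p = false.
Proof.
by move=> vA; apply/negbTE/negP => h; have := covered_within vA h; rewrite within_p.
Qed.

Lemma p_neq_np : (p == neg p) = false.
Proof. by rewrite eq_lab lab_neg lab_p; lia. Qed.

Lemma within_neq t : within m t ->
  [/\ (t == p) = false, (t == neg p) = false, (p == t) = false & (neg p == t) = false].
Proof.
by rewrite /within !eq_lab !lab_neg lab_p => h; split; lia.
Qed.

Lemma within_neg t : within m (neg t) = within m t.
Proof. by rewrite /within lab_neg; lia. Qed.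

Lemma avail_succ A : valid m A -> avail m.+1 A = p |: (neg p |: avail m A).
Proof.
move=> vA; apply/setP => t; rewrite !inE within_succ.
case: (eqVneq t p) => [->|_]; first by rewrite out_p.
by case: (eqVneq t (neg p)) => [->|_] //=; rewrite out_np.
Qed.

Lemma avail_insert A a : valid m A -> a \in avail m A ->
  avail m.+1 (insert A a) = p |: (avail m A :\ a).
Proof.
move=> vA; rewrite inE => /andP[/within_neq[a1 a2 a3 a4] _].
apply/setP => t; rewrite !inE within_succ has_out_insert.
case: (eqVneq t p) => [->|_]; first by rewrite out_p // a3 p_neq_np.
case: (eqVneq t (neg p)) => [->|_] /=; first by rewrite !orbT /= within_np andbF.
by case: (t == a); rewrite ?orbT ?orbF ?andbF.
Qed.

Lemma card_avail_succ A : valid m A -> #|avail m.+1 A| = (#|avail m A| + 2)%N.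
Proof.
move=> vA; rewrite avail_succ // !cardsU1 !inE within_p within_np p_neq_np /=.
by rewrite addnA addnC.
Qed.

Lemma card_avail_insert A a : valid m A -> a \in avail m A ->
  #|avail m.+1 (insert A a)| = #|avail m A|.
Proof.
move=> vA ha; rewrite avail_insert // cardsU1 !inE within_p andbF /=.
by rewrite [in RHS](cardsD1 a) ha.
Qed.

Lemma card_outer_arcs A (X : {set T * T}) a : valid m A -> a \in avail m A ->
  X \subset A -> #|X :|: outer_arcs a| = (#|X| + 2)%N.
Proof.
move=> vA; rewrite inE => /andP[/within_neq[a1 a2 a3 a4] _] sX.
rewrite cardsU cards2 xpair_eqE a2 /=.
suff -> : X :&: outer_arcs a = set0 by rewrite cards0 subn0.
apply/setP => e; rewrite in_setI in_set0; apply/negP => /andP[/(subsetP sX) eA].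
by rewrite (outer_arcs_notin a vA eA).
Qed.

Lemma card_insert A a : valid m A -> a \in avail m A ->
  (#|insert A a| %/ 2 = (#|A| %/ 2).+1)%N.
Proof. by move=> vA ha; rewrite (card_outer_arcs vA ha) //; lia. Qed.

Lemma covset_insert A a : covset (insert A a) =
  if lab a == m%:Z then covset A :|: outer_arcs a else covset A.
Proof.
apply/setP => e; rewrite inE; case: ifP => h; rewrite !inE;
  case: (boolP (e == (a, p))) => [/eqP->|_] /=; rewrite ?orbT ?orbF ?lab_p /=;
  try (case: (boolP (e == (neg p, neg a))) => [/eqP->|_] /=; rewrite ?orbT ?orbF //=;
       rewrite ?lab_neg ?lab_p); move: h; lia.
Qed.

Lemma covset_sub A : covset A \subset A.
Proof. by apply/subsetP => e; rewrite inE => /andP[]. Qed.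

Lemma weight_insert (R : comNzRingType) (x y : R) A a :
  valid m A -> a \in avail m A ->
  weight x y (insert A a) = (if lab a == m%:Z then y else x) * weight x y A.
Proof.
move=> vA ha; rewrite /weight covset_insert; case: ifP => h.
  have -> : insert A a :\: (covset A :|: outer_arcs a) = A :\: covset A.
    apply/setP => e; rewrite !in_setD [e \in insert A a]in_setU [e \in covset A :|: _]in_setU.
    case: (boolP (e \in A)) => [eA|_] /=; last first.
      by rewrite andbF; case: (_ \in outer_arcs a); rewrite ?orbT ?andbF.
    by rewrite (outer_arcs_notin a vA eA) orbF.
  rewrite (card_outer_arcs vA ha (covset_sub A)).
  have -> : ((#|covset A| + 2) %/ 2 = (#|covset A| %/ 2).+1)%N by lia.
  by rewrite exprS; ring.
have -> : insert A a :\: covset A = (A :\: covset A) :|: outer_arcs a.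
  apply/setP => e; rewrite in_setU !in_setD [e \in insert A a]in_setU.
  case: (boolP (e \in outer_arcs a)) => [eo|_]; rewrite ?orbT ?orbF // andbT.
  apply/negP => /(subsetP (covset_sub A)) eA.
  by rewrite (outer_arcs_notin a vA eA) in eo.
rewrite (card_outer_arcs vA ha (subsetDl _ _)).
have -> : ((#|A :\: covset A| + 2) %/ 2 = (#|A :\: covset A| %/ 2).+1)%N by lia.
by rewrite exprS; ring.
Qed.

Lemma max_avail q A : lab q = m%:Z -> valid m A -> q \in avail m A.
Proof.
move=> lq vA; rewrite inE; apply/andP; split; first by rewrite /within lq; lia.
by apply/negP => h; have := has_out_within vA h; rewrite lq; lia.
Qed.

(** A new arc uses up one available point and supplies [p], so the count is unchanged. The start [q]
    gives two covers and weighs [y]; each other start weighs [x]. *)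
Lemma sum_block_step (R : comNzRingType) (x y : R) q (g : nat -> R) :
  lab q = m%:Z ->
  \sum_(A | valid m.+1 A) weight x y A * g #|avail m.+1 A| =
  \sum_(A | valid m A) weight x y A *
    (g (#|avail m A| + 2)%N + (y + #|avail m A|.-1%:R * x) * g #|avail m A|).
Proof.
move=> lq; rewrite sum_insert; apply: eq_bigr => A vA.
rewrite card_avail_succ // mulrDr; congr (_ + _).
have hq := max_avail lq vA.
under eq_bigr => a ha do rewrite (weight_insert _ _ vA ha) (card_avail_insert vA ha).
rewrite (bigD1 q) //= lq eqxx.
rewrite (eq_bigr (fun _ => x * weight x y A * g #|avail m A|)); last first.
  by move=> a /andP[_]; rewrite eq_lab lq => /negbTE ->.
rewrite (eq_bigl (fun a => a \in (avail m A :\ q))); last by move=> a; rewrite !inE andbC.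
rewrite sumr_const.
have -> : #|avail m A|.-1 = #|avail m A :\ q| by rewrite (cardsD1 q) hq.
by rewrite -mulr_natl; ring.
Qed.

Lemma neg_neq a : lab a != 0 -> (a == neg a) = false.
Proof. by rewrite eq_lab lab_neg; lia. Qed.

(** Mirror pairs of isolated points are counted by their positive members. *)
Lemma positive_representative a : lab a != 0 ->
  exists r, [/\ 0 < lab r, r = a \/ r = neg a &
    forall t, (0 < lab t) && ((t == a) || (t == neg a)) = (t == r)].
Proof.
case: (ltrP 0 (lab a)) => h za; [exists a | exists (neg a)]; split; rewrite ?lab_neg;
  try by [left | right | lia].
- by move=> t; rewrite !eq_lab lab_neg; lia.
- by move=> t; rewrite !eq_lab lab_neg; lia.
Qed.

Definition singles k A : {set T} :=
  [set t | [&& within k t, 0 < lab t, ~~ has_in A t & ~~ has_out A t]].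
(** The point 0 belongs here even when isolated, because B-feasibility looks at nonzero elements
    only. *)
Definition others k A : {set T} :=
  [set t | [&& within k t, ~~ has_out A t & has_in A t || (lab t == 0)]].
Definition isolated k A : {set T} :=
  [set t | [&& within k t, lab t != 0, ~~ has_in A t & ~~ has_out A t]].

Lemma card_isolated A : valid m A -> #|isolated m A| = (2 * #|singles m A|)%N.
Proof.
move=> vA.
have im t : (t \in [set neg u | u in singles m A]) = (neg t \in singles m A).
  by rewrite -{1}(mirrorK t) mem_imset //; apply: can_inj mirrorK.
have -> : isolated m A = singles m A :|: [set neg t | t in singles m A].
  apply/setP => t; rewrite in_setU im !inE within_neg lab_neg.
  rewrite (has_in_neg _ vA) (has_in_neg _ vA) mirrorK.
  by case: (within m t); case: (has_out A t); case: (has_out A (neg t)) => //=; lia.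
rewrite cardsU card_imset; last exact: can_inj mirrorK.
suff -> : singles m A :&: [set neg t | t in singles m A] = set0 by rewrite cards0; lia.
apply/setP => t; rewrite in_setI im !inE.
rewrite lab_neg; case: (ltrP 0 (lab t)); rewrite ?andbF //= => h.
by rewrite [0 < - _](_ : _ = false) ?andbF //; lia.
Qed.

Lemma sum_singleton_step (R : comNzRingType) (x : R) (f : nat * nat -> R) :
  \sum_(A | valid m.+1 A) x ^+ (#|A| %/ 2) * f (#|singles m.+1 A|, #|others m.+1 A|) =
  \sum_(A | valid m A) x ^+ (#|A| %/ 2) *
    singleton_op 2 x f (#|singles m A|, #|others m A|).
Proof.
rewrite sum_insert; apply: eq_bigr => A vA; rewrite /singleton_op /=.
have lp := lab_p.
have -> : singles m.+1 A = p |: singles m A.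
  apply/setP => t; rewrite !inE within_succ.
  case: (eqVneq t p) => [->|_]; first by rewrite in_p // out_p // lp.
  case: (eqVneq t (neg p)) => [->|_] //=; rewrite within_np lab_neg lp; lia.
have -> : others m.+1 A = others m A.
  apply/setP => t; rewrite !inE within_succ.
  case: (eqVneq t p) => [->|_]; first by rewrite in_p // within_p lp andbF.
  case: (eqVneq t (neg p)) => [->|_] //=; rewrite within_np in_np // lab_neg lp; lia.
rewrite cardsU1 inE within_p /= add1n -addrA mulrDr; congr (_ + _).
(* A start among the others is replaced by [p], and no singleton changes. *)
rewrite (bigID (fun a => has_in A a || (lab a == 0))) /= mulrDr; congr (_ + _).
  rewrite (eq_bigl (fun a => a \in (others m A))); last by move=> a; rewrite !inE andbA.
  rewrite (eq_bigr (fun _ => x * x ^+ (#|A| %/ 2) *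
      f (#|singles m A|, #|others m A|))); last first.
    move=> a; rewrite inE => /and3P[wa oa ra].
    have ha : a \in avail m A by rewrite inE wa.
    have [a1 a2 a3 a4] := within_neq wa.
    rewrite (card_insert vA ha) exprS; congr (_ * f (_, _)).
      apply: eq_card => t; rewrite !inE within_succ has_out_insert has_in_insert.
      case: (eqVneq t p) => [->|_]; first by rewrite within_p !orbT /= ?andbF.
      case: (eqVneq t (neg p)) => [->|_]; first by rewrite within_np !orbT /= ?andbF.
      case: (eqVneq t a) => [->|ta]; rewrite ?orbF ?orbT /=.
        by case/orP: ra => [->|/eqP->]; rewrite ?andbF.
      case: (eqVneq t (neg a)) => [->|_]; rewrite ?orbF //=.
      case/orP: ra => [h|/eqP h]; last by rewrite lab_neg h andbF.
      by rewrite (has_in_neg _ vA) in h; rewrite h !andbF.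
    have -> : others m.+1 (insert A a) = p |: (others m A :\ a).
      apply/setP => t; rewrite !inE within_succ has_out_insert has_in_insert.
      case: (eqVneq t p) => [->|_]; first by rewrite out_p // a3 p_neq_np /= orbT.
      case: (eqVneq t (neg p)) => [->|_]; first by rewrite within_np !orbT /= ?andbF.
      case: (eqVneq t a) => [->|ta]; rewrite ?orbF ?orbT /= ?andbF //.
      case: (eqVneq t (neg a)) => [e|_]; rewrite ?orbF //=.
      rewrite {}e in ta *; rewrite orbT; case/orP: ra => [h|/eqP h].
        by rewrite (has_in_neg _ vA) in h; rewrite h !andbF.
      by move: ta; rewrite eq_lab lab_neg h.
    rewrite cardsU1 !inE within_p andbF /= [in RHS](cardsD1 a) inE wa oa ra.
    by [].
  by rewrite sumr_const -mulr_natl; ring.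
(* At an isolated start, the mirror image of [a] becomes the end of an arc: the pair leaves the
   singletons, and [p] and [neg a] join the others. *)
rewrite (eq_bigl (fun a => a \in (isolated m A))); last first.
  move=> a; rewrite !inE negb_or.
  by case: (within m a); case: (has_in A a); case: (lab a == 0); case: (has_out A a).
rewrite (eq_bigr (fun _ => x * x ^+ (#|A| %/ 2) *
    f (#|singles m A|.-1, (#|others m A| + 2)%N))); last first.
  move=> a; rewrite inE => /and4P[wa za ia oa].
  have ha : a \in avail m A by rewrite inE wa.
  have [a1 a2 a3 a4] := within_neq wa.
  have wna : within m (neg a) by rewrite within_neg.
  have [b1 b2 b3 b4] := within_neq wna.
  rewrite (card_insert vA ha) exprS; congr (_ * f (_, _)).
    have [r [r0 ra er]] := positive_representative za.
    have [wr ir or] : [/\ within m r, ~~ has_in A r & ~~ has_out A r].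
      case: ra => ->; split=> //; first by rewrite (has_in_neg _ vA) mirrorK.
      by rewrite -(has_in_neg _ vA).
    have hr : r \in singles m A by rewrite inE wr r0 ir or.
    rewrite [in RHS](cardsD1 r) hr /=; apply: eq_card => t.
    rewrite !inE within_succ has_out_insert has_in_insert -er.
    case: (eqVneq t p) => [->|_]; first by rewrite within_p !orbT /= ?andbF.
    case: (eqVneq t (neg p)) => [->|_]; first by rewrite within_np !orbT /= ?andbF.
    case: (eqVneq t a) => _; case: (eqVneq t (neg a)) => _;
      rewrite ?orbF ?orbT /= ?andbF ?andbT //;
      by case: (0 < lab t); rewrite ?andbF.
  have -> : others m.+1 (insert A a) = p |: (neg a |: others m A).
    apply/setP => t; rewrite !inE within_succ has_out_insert has_in_insert.
    case: (eqVneq t p) => [->|_]; first by rewrite out_p // a3 p_neq_np /= orbT.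
    case: (eqVneq t (neg p)) => [->|_]; first by rewrite within_np a4 b4 !orbT /= ?andbF.
    case: (eqVneq t a) => [->|ta]; rewrite ?orbF ?orbT /= ?andbF //.
      by rewrite neg_neq // (negbTE ia) (negbTE za) !andbF.
    case: (eqVneq t (neg a)) => [->|_]; rewrite ?orbF //=.
    by rewrite wna orbT -(has_in_neg _ vA) ia.
  rewrite !cardsU1 !inE within_p b3 (has_in_neg (neg a) vA) mirrorK lab_neg (negbTE oa) /=.
  by rewrite oppr_eq0 (negbTE za) !andbF /= addnA addnC.
by rewrite sumr_const (card_isolated vA) -mulr_natl; ring.
Qed.

(** * Noncrossing and poor arc sets under insertion *)

Definition nc A : bool :=
  [forall a, forall b, forall c, forall d,
     [&& (a, c) \in A, (b, d) \in A, lab a < lab b, lab b < lab c & lab c < lab d]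
       ==> ((a == neg d) && (c == neg b))].

Lemma ncP A :
  reflect (forall a b c d, (a, c) \in A -> (b, d) \in A ->
             lab a < lab b -> lab b < lab c -> lab c < lab d -> a = neg d /\ c = neg b)
          (nc A).
Proof.
apply: (iffP forallP) => h.
  move=> a b c d h1 h2 h3 h4 h5.
  have /implyP := forallP (forallP (forallP (h a) b) c) d.
  by rewrite h1 h2 h3 h4 h5 => /(_ isT) /andP[/eqP-> /eqP->].
move=> a; apply/forallP => b; apply/forallP => c; apply/forallP => d.
apply/implyP => /and5P[h1 h2 h3 h4 h5].
by have [-> ->] := h _ _ _ _ h1 h2 h3 h4 h5; rewrite !eqxx.
Qed.

(* [z] exempts the point 0, so that [poorly false] is poorness and [poorly true]
   is B-poorness. *)
Definition poorly z A : bool :=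
  [forall b, (z && (lab b == 0)) || ~~ (has_in A b && has_out A b)].

(** An old arc crosses (a, p) exactly if it covers [a]. Covering is mirror invariant, so the second
    new arc adds no condition, and a crossing between the two new arcs is of the permitted kind. *)
Lemma nc_insert A a : valid m A -> a \in avail m A ->
  nc (insert A a) = nc A && ~~ covered A a.
Proof.
move=> vA; rewrite inE => /andP[wa _]; have lp := lab_p.
have [_ [_ _ bnd]] := validP _ _ vA.
have sub e : e \in A -> e \in insert A a by move=> h; rewrite inE h.
have ap : (a, p) \in insert A a by rewrite insertE !eqxx orbT.
apply/ncP/andP => [h|[/ncP h nca] c1 c2 d1 d2].
  split; first by apply/ncP => c1 c2 d1 d2 /sub h1 /sub; apply: h.
  apply/negP => /coveredP[c [d [cd /andP[h1 h2]]]].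
  have /andP[wc wd] := bnd _ _ cd.
  have dp : lab d < lab p by move: wd; rewrite /within lp; lia.
  have [e _] := h _ _ _ _ (sub _ cd) ap h1 h2 dp.
  by move: wc; rewrite e within_np.
move: wa; rewrite !insertE /within => wa.
case/or3P => [h1|/andP[/eqP-> /eqP->]|/andP[/eqP-> /eqP->]];
  case/or3P => [h2|/andP[/eqP-> /eqP->]|/andP[/eqP-> /eqP->]] l1 l2 l3.
- exact: h h1 h2 l1 l2 l3.
- by case/negP: nca; apply/coveredP; exists c1, d1; rewrite l1 l2.
- by have := bnd _ _ h1; move: l1; rewrite /within lab_neg lp; clear; lia.
- by have := bnd _ _ h2; move: l3; rewrite /within lp; clear; lia.
- by rewrite ltxx in l1.
- by move: l1; rewrite lab_neg lp; move: wa; clear; lia.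
- case/negP: nca; rewrite -(covered_neg _ vA).
  by apply/coveredP; exists c2, d2; rewrite l2 l3.
- by [].
- by rewrite ltxx in l1.
Qed.

(** Whether poorness lets an arc start at [a]. The point 0 is its own mirror image and would receive
    both new arcs, which only the exemption [z] permits. *)
Definition open_end z A a : bool := if lab a == 0 then z else ~~ has_in A a.

Lemma poorly_insert z A a : valid m A -> a \in avail m A ->
  poorly z (insert A a) = poorly z A && open_end z A a.
Proof.
move=> vA; rewrite inE => /andP[/within_neq[a1 a2 a3 a4] oa].
rewrite /poorly /open_end; apply/forallP/andP => [h|[/forallP h1 h2] b].
  split.
    apply/forallP => b; have := h b; rewrite has_in_insert has_out_insert.
    by case: (_ && _) => //=; apply: contra => /andP[-> ->].
  have := h a; rewrite has_in_insert has_out_insert eqxx orbT andbT.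
  case: ifP => ha; last by rewrite andbF /= negb_or => /andP[].
  have -> : a == neg a by rewrite eq_lab lab_neg; move: ha; clear; lia.
  by rewrite !orbT andbT orbF.
have := h1 b; rewrite has_in_insert has_out_insert.
case: (boolP (z && (lab b == 0))) => //= zb nb.
have nn : (b == neg a) -> has_out A b = has_in A a.
  by move=> /eqP ->; rewrite (has_in_neg a vA).
have lb : (b == neg a) -> (lab b == 0) = (lab a == 0).
  by move=> /eqP ->; rewrite lab_neg oppr_eq0.
apply/negP => /andP[/or3P[i1|/eqP i1|i1] /or3P[o1|/eqP o1|/eqP o1]].
- by rewrite i1 o1 in nb.
- by move: h2 zb i1; rewrite -o1; case: ifP => _ => [->|/negbTE->].
- by rewrite o1 in_np in i1.
- by rewrite i1 out_p in o1.
- by rewrite -o1 i1 eqxx in a1.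
- by have := p_neq_np; rewrite -[X in X == _]i1 o1 eqxx.
- move: h2 zb; rewrite (lb i1) -(nn i1) o1.
  by case: ifP => // _ ->.
- move: h2 zb; rewrite (lb i1); move: i1; rewrite o1.
  case: ifP => [_ _ -> //|h]; by rewrite neg_neq // h.
- by move: i1; rewrite o1 (inj_eq (can_inj mirrorK)) a3.
Qed.

(* The reachable points that stay reachable once an arc has been drawn from [a];
   in the poor case ([b = false]) the point [- a] is used up as well. *)
Definition after (b : bool) a c : bool :=
  if b then - lab a <= lab c < lab a else - lab a < lab c < lab a.
Arguments after : simpl never.

Definition reach A t : bool := ~~ has_out A t && ~~ covered A t.

(** For a nonnegative start, the new arcs cover what lies outside [-a, a], and [a] is used up. For a
    negative start they overlap and cover every old point. *)
Lemma reach_insert A a t : valid m A -> within m a -> within m t ->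
  reach (insert A a) t = after true a t && reach A t.
Proof.
move=> vA wa wt; rewrite /reach has_out_insert covered_insert.
have [_ -> _ _] := within_neq wt; rewrite orbF eq_lab lab_p.
case: (has_out A t); rewrite ?andbF //=; case: (covered A t); rewrite ?andbF //=.
by move: wa wt; rewrite /after /within; clear; lia.
Qed.

Lemma reach_insert_p A a : valid m A -> within m a -> reach (insert A a) p.
Proof.
move=> vA wa; have [a1 a2 a3 a4] := within_neq wa.
rewrite /reach has_out_insert covered_insert out_p // a3 p_neq_np covered_p // lab_p.
by move: wa; rewrite /within; clear; lia.
Qed.

Lemma reach_insert_np A a : reach (insert A a) (neg p) = false.
Proof. by rewrite /reach has_out_insert eqxx !orbT. Qed.

Definition reach_end z A t : bool := reach A t && open_end z A t.

(** Here -a drops out too, because an arc now ends there. *)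
Lemma reach_end_insert z A a t : valid m A -> within m a -> within m t ->
  reach_end z (insert A a) t = after false a t && reach_end z A t.
Proof.
move=> vA wa wt; rewrite /reach_end reach_insert // /open_end has_in_insert.
have [-> _ _ _] := within_neq wt; rewrite orFb eq_lab lab_neg.
case: (reach A t); rewrite ?andbF ?andbT //=.
by case: (has_in A t) => /=; case: z; case: eqP => h;
  rewrite /= ?andbT ?andbF // /after; move: h; clear; lia.
Qed.

Lemma reach_end_insert_p z A a : reach_end z (insert A a) p = false.
Proof.
rewrite /reach_end /open_end has_in_insert eqxx !orbT lab_p.
by rewrite [_ == 0](_ : _ = false) ?andbF.
Qed.

Lemma reach_end_insert_np z A a : reach_end z (insert A a) (neg p) = false.
Proof. by rewrite /reach_end reach_insert_np. Qed.

Lemma reach_p A : valid m A -> reach A p /\ reach A (neg p).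
Proof.
by move=> vA; rewrite /reach out_p // out_np // (covered_neg _ vA) covered_p.
Qed.

Lemma reach_end_p z A : valid m A -> reach_end z A p /\ reach_end z A (neg p).
Proof.
move=> vA; have [h1 h2] := reach_p vA; rewrite /reach_end h1 h2 /open_end.
by rewrite in_p // in_np // lab_neg lab_p.
Qed.

(** A list, so that a label without a point, such as 0 in type D, contributes nothing. *)
Definition points_at (z : int) : seq T := [seq t <- enum T | lab t == z].

(* The order within the pairs [k], [- k] makes the points satisfying [after b a]
   come later in the list than [a]. *)
Fixpoint outer_first (b : bool) k : seq T :=
  if k is k'.+1 then
    (if b then points_at k ++ points_at (- k%:Z) else points_at (- k%:Z) ++ points_at k)
    ++ outer_first b k'
  else points_at 0.

Definition signs (L : seq T) : seq bool := [seq 0 <= lab t | t <- L].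

Lemma points_at_lab t : points_at (lab t) = [:: t].
Proof.
rewrite /points_at -(@filter_pred1_uniq _ (enum T) t (enum_uniq _) (mem_enum _ _)).
by apply: eq_filter => u; rewrite /= -eq_lab.
Qed.

Lemma mem_points_at z t : (t \in points_at z) = (lab t == z).
Proof. by rewrite mem_filter mem_enum andbT. Qed.

Lemma points_atP z : points_at z = [::] \/ exists2 t, lab t = z & points_at z = [:: t].
Proof.
case: (pickP (fun t => lab t == z)) => [t /eqP <-|no].
  by right; exists t; rewrite ?points_at_lab.
by left; rewrite /points_at (eq_filter no) filter_pred0.
Qed.

Lemma mem_outer_first (b : bool) k t : (t \in outer_first b k) = within k t.
Proof.
elim: k => [|k IH]; rewrite /= ?mem_cat ?mem_points_at ?IH.
  by rewrite /within; clear; lia.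
by case: b {IH}; rewrite mem_cat !mem_points_at /within; clear; lia.
Qed.

Lemma outer_first_uniq (b : bool) k : uniq (outer_first b k).
Proof.
have up z : uniq (points_at z) by rewrite filter_uniq // enum_uniq.
elim: k => [|k IH] //=; rewrite cat_uniq IH andbT.
have d (s : seq T) (z : int) : {in s, forall t, lab t != z} ->
    ~~ has (mem s) (points_at z).
  move=> h; apply/hasPn => t; rewrite mem_points_at => ht; apply/negP => /h.
  by rewrite ht.
apply/andP; split.
  by case: b {IH}; rewrite cat_uniq !up andbT; apply: d => t;
    rewrite mem_points_at => /eqP->; clear; lia.
apply/hasPn => t; rewrite mem_outer_first /within => h; apply/negP.
by case: b {IH} => /=; rewrite mem_cat !mem_points_at; move: h; clear; lia.
Qed.

Lemma outer_first_pairwise (b : bool) k :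
  pairwise (fun a c => ~~ after b c a && ((0 <= lab a) ==> after b a c))
           (outer_first b k).
Proof.
elim: k => [|k IH] /=.
  by case: (points_atP 0) => [->|[t _ ->]].
have h c : c \in outer_first b k -> within k c by rewrite mem_outer_first.
rewrite pairwise_cat IH andbT; apply/andP; split.
  apply/allrelP => a c ha /h; rewrite /within /after => hc.
  have {}ha : (lab a == k.+1%:Z) || (lab a == - k.+1%:Z).
    by move: ha; case: (b); rewrite mem_cat !mem_points_at // orbC.
  by move: ha hc; case: (b); clear; lia.
case: (points_atP k.+1) => [->|[t ht ->]]; case: (points_atP (- k.+1%:Z)) => [->|[u hu ->]];
  rewrite ?cats0 ?cat0s; case: (b) => //=; rewrite ?andbT /after ht hu; clear; lia.
Qed.

Lemma outer_first_p (b : bool) : outer_first b m.+1 =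
  (if b then [:: p; neg p] else [:: neg p; p]) ++ outer_first b m.
Proof.
rewrite /= -lab_p -[- lab p]lab_neg !points_at_lab.
by case: b.
Qed.

(** The starts are listed in [outer_first] order, the form in which [psi_choice] can sum over
    them. *)
Lemma sum_insert_cond (V : nmodType) (b : bool) (C : pred {set T * T})
    (D : {set T * T} -> pred T) (F : {set T * T} -> V) :
  (forall A a, valid m A -> a \in avail m A -> C (insert A a) = C A && D A a) ->
  \sum_(A | valid m.+1 A && C A) F A =
  \sum_(A | valid m A && C A) (F A +
    \sum_(a <- [seq t <- outer_first b m | ~~ has_out A t && D A t]) F (insert A a)).
Proof.
move=> hC; rewrite big_mkcondr sum_insert [RHS]big_mkcondr; apply: eq_bigr => A vA.
case: (boolP (C A)) => cA; last first.
  rewrite add0r big1 // => a ha; rewrite hC // (negbTE cA) //.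
congr (_ + _); rewrite big_uniq; last by rewrite filter_uniq // outer_first_uniq.
rewrite [RHS](eq_bigl (fun a => (a \in avail m A) && D A a)); last first.
  by move=> a; rewrite mem_filter mem_outer_first inE andbC andbA.
by rewrite [RHS]big_mkcondr; apply: eq_bigr => a ha; rewrite hC // cA.
Qed.

Lemma filter_pairwise (b : bool) (Q : pred T) k :
  pairwise (fun a c => ~~ after b c a && ((0 <= lab a) ==> after b a c))
           [seq t <- outer_first b k | Q t].
Proof. exact: subseq_pairwise (filter_subseq _ _) (outer_first_pairwise b k). Qed.

Lemma after_irr (b : bool) : irreflexive (after b).
Proof. by case: b => a; rewrite /after; clear; lia. Qed.

Lemma after_sign (b : bool) a c : after b a c -> 0 <= lab a.
Proof. by case: b; rewrite /after; clear; lia. Qed.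

Section Steps.
Variables (R : comNzRingType) (x y : R).

(** [behead] removes the largest point, which is always reachable and heads the list. Its arc is
    weighed by [y] and is treated apart from the choices counted by [psi]. *)
Lemma sum_nc_step q (f : nat -> R) : lab q = m%:Z ->
  \sum_(A | valid m.+1 A && nc A)
     weight x y A * psi f (behead (signs [seq t <- outer_first true m.+1 | reach A t])) =
  \sum_(A | valid m A && nc A)
     weight x y A * psi (add_scalar (fold_op x) (1 + y) f)
       (behead (signs [seq t <- outer_first true m | reach A t])).
Proof.
move=> lq; rewrite (sum_insert_cond true _ nc_insert).
apply: eq_bigr => A /andP[vA _]; rewrite outer_first_p /=.
have [-> ->] := reach_p vA.
set L := [seq t <- outer_first true m | _].
have Lin a : a \in L -> within m a /\ a \in avail m A.
  by rewrite mem_filter mem_outer_first inE => /andP[/andP[-> _] ->].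
pose r := [seq t <- behead (outer_first true m) | reach A t].
have eL : L = q :: r.
  have hq : reach A q.
    have := max_avail lq vA; rewrite /reach inE => /andP[_ ->] /=.
    apply/negP => /coveredP[c [d [cd]]]; have [_ [_ _ bnd]] := validP _ _ vA.
    by have := bnd _ _ cd; rewrite /within lq; clear; lia.
  rewrite /L /r; case: (m) lq => [|k] lq /=.
    by rewrite -[0]lq points_at_lab /= -/(reach A q) hq.
  by rewrite -lq points_at_lab /= -/(reach A q) hq.
have pw : pairwise (fun a c => ~~ after true c a && ((0 <= lab a) ==> after true a c)) L.
  exact: filter_pairwise.
have step a : a \in L -> weight x y (insert A a) *
    psi f (behead (signs [seq t <- p :: neg p :: outer_first true m | reach (insert A a) t])) =
    (if lab a == m%:Z then y else x) * weight x y A *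
      psi f (signs [seq t <- L | after true a t]).
  move=> /Lin[wa ha]; rewrite weight_insert //=.
  rewrite reach_insert_p // reach_insert_np /=; congr (_ * psi f (signs _)).
  rewrite -filter_predI; apply: eq_in_filter => t; rewrite mem_outer_first => wt.
  by rewrite reach_insert.
rewrite (eq_big_seq _ step) eL big_cons lq eqxx /=.
move: pw; rewrite eL /= => /andP[/allP hq pw].
rewrite after_irr.
have -> : [seq t <- r | after true q t] = r.
  apply/all_filterP/allP => c /hq /andP[_]; rewrite lq.
  by rewrite [0 <= _](_ : _ = true).
have step2 a : a \in r ->
   (if lab a == m%:Z then y else x) * weight x y A *
     psi f (signs (if after true a q then q :: [seq t <- r | after true a t]
                   else [seq t <- r | after true a t])) =
   weight x y A * (x * psi f (signs [seq t <- r | after true a t])).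
  move=> ar; have /andP[/negbTE -> _] := hq _ ar.
  have : a != q.
    have := filter_uniq (reach A) (outer_first_uniq true m); rewrite -/L eL /=.
    by case/andP => h _; apply: contraNneq h => <-.
  by rewrite eq_lab lq => /negbTE ->; ring.
rewrite (eq_big_seq _ step2) -!mulr_sumr psi_choice //; last exact: after_sign.
  have -> : (0 <= lab (neg p)) = false by rewrite lab_neg lab_p.
  have -> : (0 <= lab q) = true by rewrite lq.
  by rewrite psi_fold_op /=; ring.
exact: after_irr.
Qed.

(** With one variable covers weigh like other arcs, so no point is set apart. After an insertion
    neither new point is open, and only old points remain in the list. *)
Lemma sum_poor_step z (f : nat -> R) :
  \sum_(A | valid m.+1 A && (nc A && poorly z A))
     x ^+ (#|A| %/ 2) * psi f (signs [seq t <- outer_first false m.+1 | reach_end z A t]) =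
  \sum_(A | valid m A && (nc A && poorly z A))
     x ^+ (#|A| %/ 2) * psi (add_scalar (fold_op x) 1 f)
       (signs [seq t <- outer_first false m | reach_end z A t]).
Proof.
have hC A a : valid m A -> a \in avail m A -> nc (insert A a) && poorly z (insert A a) =
    (nc A && poorly z A) && (~~ covered A a && open_end z A a).
  by move=> vA ha; rewrite nc_insert // poorly_insert // andbACA.
rewrite (sum_insert_cond false _ hC).
apply: eq_bigr => A /andP[vA _]; rewrite outer_first_p /=.
have [-> ->] := reach_end_p z vA.
rewrite (@eq_filter _ (fun t => ~~ has_out A t && _) (reach_end z A)); last first.
  by move=> t; rewrite /reach_end /reach andbA.
set L := [seq t <- outer_first false m | _].
have step a : a \in L -> x ^+ (#|insert A a| %/ 2) *
    psi f (signs [seq t <- neg p :: p :: outer_first false m | reach_end z (insert A a) t]) =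
    x ^+ (#|A| %/ 2) * (x * psi f (signs [seq t <- L | after false a t])).
  rewrite mem_filter mem_outer_first => /andP[/andP[/andP[oa _] _] wa].
  rewrite card_insert ?inE ?wa // exprSr -mulrA; congr (_ * (_ * psi f (signs _))).
  rewrite /= reach_end_insert_p reach_end_insert_np -filter_predI.
  apply: eq_in_filter => t; rewrite mem_outer_first => wt.
  by rewrite reach_end_insert.
rewrite (eq_big_seq _ step) -!mulr_sumr psi_choice.
- rewrite /signs /=.
  have -> : (0 <= lab p) = true by rewrite lab_p.
  have -> : (0 <= lab (neg p)) = false by rewrite lab_neg lab_p.
  (* [psi_fold_op] is applied with y = 0. *)
  by rewrite -[1 in RHS]addr0 psi_fold_op /=; ring.
- exact: after_irr.
- exact: after_sign.
- exact: filter_pairwise.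
Qed.

End Steps.
End Insertion.
End Mirror.

(** * Arc sets on positive labels *)

Section Increasing.
Variables (T : finType) (lab : T -> int).
Hypothesis lab_inj : injective lab.
Implicit Types (A : {set T * T}) (a b c d t : T) (m : nat).

Definition below m A : bool := arcset lab A && [forall e in A, lab e.2 <= m%:Z].
Definition lone m A : {set T} :=
  [set t | [&& lab t <= m%:Z, ~~ has_in A t & ~~ has_out A t]].
Definition closing m A : {set T} :=
  [set t | [&& lab t <= m%:Z, has_in A t & ~~ has_out A t]].

Lemma belowP m A :
  reflect ([/\ forall a b, (a, b) \in A -> lab a < lab b,
               forall a b c, (a, b) \in A -> (a, c) \in A -> b = c &
               forall a b c, (a, c) \in A -> (b, c) \in A -> a = b] /\
           forall a b, (a, b) \in A -> lab b <= m%:Z)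
          (below m A).
Proof.
apply: (iffP andP) => -[h1 h2]; split.
- exact/arcsetP.
- by move=> a b; apply: (forall_inP h2 (a, b)).
- exact/arcsetP.
- by apply/forall_inP => -[a b]; apply: h2.
Qed.

Section Insertion.
Variables (m : nat) (p : T).
Hypothesis lab_p : lab p = m.+1%:Z.

Lemma below_noin A : below m.+1 A && ~~ has_in A p = below m A.
Proof.
apply/andP/idP => [[/belowP[h1 bnd] ni]|/belowP[h1 bnd]].
  apply/belowP; split=> // a b ab.
  have : lab b != lab p.
    by apply: contraNneq ni => /lab_inj e; apply/has_inP; exists a; rewrite -e.
  by have := bnd _ _ ab; rewrite lab_p; clear; lia.
split; first by apply/belowP; split=> // a b /bnd; clear; lia.
by apply/negP => /has_inP[a /bnd]; rewrite lab_p; clear; lia.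
Qed.

Lemma below_outside A t : below m A -> (m%:Z < lab t) ->
  (has_in A t = false) * (has_out A t = false).
Proof.
move=> /belowP[[mono _ _] bnd] lt; split; apply/negbTE/negP.
  by move=> /has_inP[a /bnd]; move: lt; clear; lia.
by move=> /has_outP[a ta]; have := mono _ _ ta; have := bnd _ _ ta; move: lt; clear; lia.
Qed.

Lemma setU1_below B a :
  below m.+1 ((a, p) |: B) && (((a, p) |: B) :\ (a, p) == B) =
  below m B && ((lab a <= m%:Z) && ~~ has_out B a).
Proof.
apply/andP/andP => [[/belowP[[mono out1 in1] bnd] /eqP eB]|[vB /andP[la oa]]].
  have sub e : e \in B -> e \in (a, p) |: B by rewrite inE orbC => ->.
  have ap : (a, p) \in (a, p) |: B by rewrite setU11.
  have nap : (a, p) \notin B by rewrite -eB !inE eqxx.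
  split.
    apply/belowP; split; first split.
    - by move=> c d /sub /mono.
    - by move=> c d e /sub cd /sub /(out1 _ _ _ cd).
    - by move=> c d e /sub cd /sub /(in1 _ _ _ cd).
    - move=> c d cd; have := bnd _ _ (sub _ cd).
      have : lab d != lab p.
        apply: contraNneq nap => /lab_inj e; rewrite e in cd.
        by rewrite -(in1 _ _ _ (sub _ cd) ap).
      by rewrite lab_p; clear; lia.
  apply/andP; split; first by have := mono _ _ ap; rewrite lab_p; clear; lia.
  apply/negP => /has_outP[d ad].
  by have := ad; rewrite (out1 _ _ _ (sub _ ad) ap) (negbTE nap).
have [[mono out1 in1] bnd] := belowP _ _ vB.
have lp : m%:Z < lab p by rewrite lab_p; clear; lia.
have [ip op] := below_outside vB lp.
have noout d : (a, d) \notin B by apply: contra oa => h; apply/has_outP; exists d.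
have noin d : (d, p) \notin B by apply/negP => h; move/has_inP: ip; apply; exists d.
split; last by apply/eqP/setU1K.
have E c d : ((c, d) \in (a, p) |: B) = ((c == a) && (d == p)) || ((c, d) \in B).
  by rewrite !inE xpair_eqE.
apply/belowP; split; first split.
- move=> c d; rewrite E => /orP[/andP[/eqP-> /eqP->]|/mono //].
  by move: la; rewrite lab_p; clear; lia.
- move=> c d e; rewrite !E => /orP[/andP[/eqP h1 /eqP k1]|h1] /orP[/andP[/eqP h2 /eqP k2]|h2].
  + by rewrite k1 k2.
  + by rewrite h1 (negbTE (noout _)) in h2.
  + by rewrite h2 (negbTE (noout _)) in h1.
  + exact: out1 h1 h2.
- move=> c d e; rewrite !E => /orP[/andP[/eqP h1 /eqP k1]|h1] /orP[/andP[/eqP h2 /eqP k2]|h2].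
  + by rewrite h1 h2.
  + by rewrite k1 (negbTE (noin _)) in h2.
  + by rewrite k2 (negbTE (noin _)) in h1.
  + exact: in1 h1 h2.
- move=> c d; rewrite E => /orP[/andP[_ /eqP->]|/bnd]; rewrite ?lab_p; clear; lia.
Qed.

Lemma sum_setU1 (V : nmodType) (F : {set T * T} -> V) :
  \sum_(A | below m.+1 A) F A =
  \sum_(A | below m A)
    (F A + \sum_(a | (lab a <= m%:Z) && ~~ has_out A a) F ((a, p) |: A)).
Proof.
rewrite (bigID (fun A => has_in A p)) /= addrC big_split /=; congr (_ + _).
  by apply: eq_bigl => A; rewrite below_noin.
transitivity (\sum_(A | below m.+1 A) \sum_(a | (a, p) \in A) F A).
  rewrite big_mkcondr; apply: eq_bigr => A /belowP[[_ _ in1] _].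
  case: (boolP (has_in A p)) => [/has_inP[a ap]|/has_inP no].
    rewrite (big_pred1 a) // => b; apply/idP/eqP => [bp|-> //].
    exact: in1 bp ap.
  by rewrite big_pred0 // => a; apply/negP => ap; apply: no; exists a.
rewrite (exchange_big_dep predT) //= [RHS](exchange_big_dep predT) //=.
apply: eq_bigr => a _.
rewrite (reindex_onto (fun B => (a, p) |: B) (fun A => A :\ (a, p))) /=; last first.
  by move=> A /andP[_ ap]; rewrite setD1K.
by apply: eq_bigl => B; rewrite -setU1_below setU11 andbT.
Qed.

(** Without a mirror image only the new point joins the non-singletons, whence [d = 1]. *)
Lemma sum_lone_step (R : comNzRingType) (x : R) (f : nat * nat -> R) :
  \sum_(A | below m.+1 A) x ^+ #|A| * f (#|lone m.+1 A|, #|closing m.+1 A|) =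
  \sum_(A | below m A) x ^+ #|A| * singleton_op 1 x f (#|lone m A|, #|closing m A|).
Proof.
rewrite sum_setU1; apply: eq_bigr => A vA; rewrite /singleton_op /=.
have lp : m%:Z < lab p by rewrite lab_p; clear; lia.
have [ip op] := below_outside vA lp.
have les t : (lab t <= m.+1%:Z) = (t == p) || (lab t <= m%:Z).
  by rewrite -(inj_eq lab_inj) lab_p; clear; lia.
have lep : (lab p <= m%:Z) = false by move: lp; clear; lia.
have -> : lone m.+1 A = p |: lone m A.
  apply/setP => t; rewrite !inE les.
  by case: (eqVneq t p) => [->|_] //=; rewrite ip op.
have -> : closing m.+1 A = closing m A.
  apply/setP => t; rewrite !inE les.
  by case: (eqVneq t p) => [->|_] //=; rewrite ip lep.
rewrite cardsU1 inE lep /= add1n -addrA mulrDr; congr (_ + _).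
have out_ins a t : has_out ((a, p) |: A) t = has_out A t || (t == a).
  apply/has_outP/orP => [[d]|[/has_outP[d td]|/eqP->]].
  - by rewrite !inE xpair_eqE => /orP[/andP[-> _]|h]; [right|left; apply/has_outP; exists d].
  - by exists d; rewrite inE td orbT.
  - by exists p; rewrite setU11.
have in_ins a t : has_in ((a, p) |: A) t = has_in A t || (t == p).
  apply/has_inP/orP => [[d]|[/has_inP[d td]|/eqP->]].
  - by rewrite !inE xpair_eqE => /orP[/andP[_ ->]|h]; [right|left; apply/has_inP; exists d].
  - by exists d; rewrite inE td orbT.
  - by exists a; rewrite setU11.
have neq a : lab a <= m%:Z -> ((p == a) = false) * ((a == p) = false).
  by move=> la; rewrite -!(inj_eq lab_inj) lab_p; move: la; clear; split; lia.
have card_ins a : lab a <= m%:Z -> #|(a, p) |: A| = #|A|.+1.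
  move=> la; rewrite cardsU1 [_ \notin _](_ : _ = true) //; apply/negP => h.
  by move/has_inP: ip; apply; exists a.
have lone_ins a : lab a <= m%:Z -> lone m.+1 ((a, p) |: A) = lone m A :\ a.
  move=> la; apply/setP => t; rewrite !inE les out_ins in_ins.
  case: (eqVneq t p) => [->|_] /=; first by rewrite orbT lep andbF.
  by case: (t == a); rewrite ?orbT ?orbF ?andbF.
rewrite (bigID (fun a => has_in A a)) /= mulrDr; congr (_ + _).
  rewrite (eq_bigl (fun a => a \in closing m A)); last first.
    by move=> a; rewrite inE -andbA; congr (_ && _); rewrite andbC.
  rewrite (eq_bigr (fun _ => x * x ^+ #|A| * f (#|lone m A|, #|closing m A|))); last first.
    move=> a; rewrite inE => /and3P[la ia oa].
    rewrite card_ins // lone_ins // exprS; congr (_ * f (_, _)).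
      by rewrite [in RHS](cardsD1 a) !inE ia andbF.
    have -> : closing m.+1 ((a, p) |: A) = p |: (closing m A :\ a).
      apply/setP => t; rewrite !inE les out_ins in_ins.
      case: (eqVneq t p) => [->|_] /=; first by rewrite orbT op (neq _ la).
      by case: (t == a); rewrite ?orbT ?orbF ?andbF.
    by rewrite cardsU1 !inE lep andbF /= [in RHS](cardsD1 a) inE la ia oa.
  by rewrite sumr_const -mulr_natl; ring.
rewrite (eq_bigl (fun a => a \in lone m A)); last first.
  by move=> a; rewrite inE -andbA; congr (_ && _); rewrite andbC.
rewrite (eq_bigr (fun _ => x * x ^+ #|A| *
    f (#|lone m A|.-1, (#|closing m A| + 1)%N))); last first.
  move=> a; rewrite inE => /and3P[la ia oa].
  rewrite card_ins // lone_ins // exprS; congr (_ * f (_, _)).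
    by rewrite [in RHS](cardsD1 a) inE la ia oa.
  have -> : closing m.+1 ((a, p) |: A) = p |: closing m A.
    apply/setP => t; rewrite !inE les out_ins in_ins.
    case: (eqVneq t p) => [->|_] /=; first by rewrite orbT op (neq _ la).
    by rewrite orbF; case: (eqVneq t a) => [->|_]; rewrite ?orbF // (negbTE ia) !andbF.
  by rewrite cardsU1 !inE lep /= addnC.
by rewrite sumr_const -mulr_natl mul1n; ring.
Qed.

End Insertion.
End Increasing.

(** * Summation over all levels *)

(** Lowering the level by one is paid for by applying [T] to the test function, until the base level
    evaluates it at the initial state. *)
Lemma iter_levels (S : Type) (R : comNzRingType) (L : nat -> (S -> R) -> R) T n :
  (forall i f, (i < n)%N -> L i.+1 f = L i (T f)) ->
  forall f, L n f = L 0%N (iter n T f).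
Proof.
elim: n => [|n IH] //= h f; rewrite h // IH -?iterSr // => i g hi.
by apply: h; apply: ltnW.
Qed.

Section MirrorSums.
Variables (T : finType) (lab : T -> int) (neg : T -> T) (m0 n : nat).
Hypothesis lab_inj : injective lab.
Hypothesis lab_neg : forall t, lab (neg t) = - lab t.
Hypothesis lab_onto : forall i, (m0 <= i <= m0 + n)%N -> exists t, lab t = i%:Z.
(** The base level is [m0 = 0] with the point 0 in type B, and [m0 = 1] with the points 1 and -1 in
    type D. *)
Hypothesis within_base : forall t, within lab m0 t -> `|lab t|%N = m0.
Hypothesis within_top : forall t, within lab (m0 + n) t.
Variables (R : comNzRingType) (x y : R).
Implicit Types (A : {set T * T}).

Lemma valid_top A : valid lab neg (m0 + n) A = symarcs lab neg A.
Proof.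
rewrite /valid; case: (symarcs _ _ _) => //=.
by apply/forall_inP => e _; rewrite !within_top.
Qed.

Lemma sum_valid_base (C : pred {set T * T}) (F : {set T * T} -> R) : C set0 ->
  \sum_(A | valid lab neg m0 A && C A) F A = F set0.
Proof.
move=> h; apply: big_pred1 => A; rewrite (valid_noarc lab_inj lab_neg) //.
by rewrite /=; case: eqVneq => [->|_] //; rewrite h.
Qed.

Lemma nc_set0 : nc lab neg set0.
Proof. by apply/ncP => a b c d; rewrite inE. Qed.

Lemma has_out_set0 (t : T) : has_out set0 t = false.
Proof. by apply/negbTE/negP => /has_outP[b]; rewrite inE. Qed.

Lemma has_in_set0 (t : T) : has_in set0 t = false.
Proof. by apply/negbTE/negP => /has_inP[b]; rewrite inE. Qed.

Lemma reach_set0 t : reach lab set0 t.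
Proof.
by rewrite /reach has_out_set0; apply/negP => /coveredP[c [d []]]; rewrite inE.
Qed.

Lemma poorly_set0 z : poorly lab z set0.
Proof. by apply/forallP => b; rewrite has_in_set0 orbT. Qed.

Lemma weight_set0 : weight lab x y set0 = 1.
Proof.
have e : covset lab set0 = set0 by apply/setP => e; rewrite !inE.
by rewrite /weight e setD0 cards0 mulr1.
Qed.

Lemma lab_step i : (i < n)%N ->
  exists p q, lab p = (m0 + i).+1%:Z /\ lab q = (m0 + i)%:Z.
Proof.
move=> hi; have [p hp] := @lab_onto (m0 + i).+1 ltac:(lia).
by have [q hq] := @lab_onto (m0 + i) ltac:(lia); exists p, q.
Qed.

Lemma sum_block (g : nat -> R) :
  \sum_(A | symarcs lab neg A) weight lab x y A * g #|avail lab (m0 + n) A| =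
  iter n (fun g b => g (b + 2)%N + (y + b.-1%:R * x) * g b) g (size (outer_first lab true m0)).
Proof.
pose L i g := \sum_(A | valid lab neg (m0 + i) A && true)
  weight lab x y A * g #|avail lab (m0 + i) A|.
transitivity (L n g).
  by apply: eq_bigl => A; rewrite valid_top andbT.
rewrite (@iter_levels _ _ L (fun g b => g (b + 2)%N + (y + b.-1%:R * x) * g b)).
  rewrite /L addn0 sum_valid_base // weight_set0 mul1r; congr (iter _ _ _ _).
  rewrite -(card_uniqP (outer_first_uniq lab true m0)); apply: eq_card => t.
  by rewrite mem_outer_first inE has_out_set0 andbT.
move=> i f /lab_step[p [q [hp hq]]]; rewrite /L addnS.
by under eq_bigl do rewrite andbT; rewrite (sum_block_step lab_inj lab_neg hp x y f hq);
  apply: eq_bigl => A; rewrite andbT.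
Qed.

Lemma sum_singleton (f : nat * nat -> R) :
  \sum_(A | symarcs lab neg A)
    x ^+ (#|A| %/ 2) * f (#|singles lab (m0 + n) A|, #|others lab (m0 + n) A|) =
  iter n (singleton_op 2 x) f (#|singles lab m0 set0|, #|others lab m0 set0|).
Proof.
pose L i f := \sum_(A | valid lab neg (m0 + i) A && true)
  x ^+ (#|A| %/ 2) * f (#|singles lab (m0 + i) A|, #|others lab (m0 + i) A|).
transitivity (L n f).
  by apply: eq_bigl => A; rewrite valid_top andbT.
rewrite (@iter_levels _ _ L (singleton_op 2 x)).
  by rewrite /L addn0 sum_valid_base // cards0 mul1r.
move=> i g /lab_step[p [q [hp _]]]; rewrite /L addnS.
by under eq_bigl do rewrite andbT; rewrite (sum_singleton_step lab_inj lab_neg hp x g);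
  apply: eq_bigl => A; rewrite andbT.
Qed.

Lemma sum_nc :
  \sum_(A | symarcs lab neg A && nc lab neg A) weight lab x y A =
  psi (iter n (add_scalar (fold_op x) (1 + y)) (delta0 R))
    (behead (signs lab (outer_first lab true m0))).
Proof.
pose L i f := \sum_(A | valid lab neg (m0 + i) A && nc lab neg A) weight lab x y A *
  psi f (behead (signs lab [seq t <- outer_first lab true (m0 + i) | reach lab A t])).
transitivity (L n (delta0 R)).
  by apply: eq_big => A; rewrite ?valid_top // psi_delta0 mulr1.
rewrite (@iter_levels _ _ L (add_scalar (fold_op x) (1 + y))).
  rewrite /L addn0 sum_valid_base ?nc_set0 // weight_set0 mul1r.
  by rewrite (eq_filter reach_set0) filter_predT.
move=> i g /lab_step[p [q [hp hq]]]; rewrite /L addnS.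
exact: (sum_nc_step lab_inj lab_neg hp x y g hq).
Qed.

Lemma sum_poor z :
  \sum_(A | symarcs lab neg A && (nc lab neg A && poorly lab z A)) x ^+ (#|A| %/ 2) =
  psi (iter n (add_scalar (fold_op x) 1) (delta0 R))
    (signs lab [seq t <- outer_first lab false m0 | (lab t == 0) ==> z]).
Proof.
pose L i f := \sum_(A | valid lab neg (m0 + i) A && (nc lab neg A && poorly lab z A))
  x ^+ (#|A| %/ 2) *
  psi f (signs lab [seq t <- outer_first lab false (m0 + i) | reach_end lab z A t]).
transitivity (L n (delta0 R)).
  by apply: eq_big => A; rewrite ?valid_top // psi_delta0 mulr1.
rewrite (@iter_levels _ _ L (add_scalar (fold_op x) 1)).
  rewrite /L addn0 (sum_valid_base (C := fun A => nc lab neg A && poorly lab z A)); last first.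
    by rewrite nc_set0 poorly_set0.
  rewrite cards0 mul1r; congr (psi _ (signs _ _)); apply: eq_filter => t.
  by rewrite /reach_end reach_set0 /open_end has_in_set0; case: eqP.
move=> i g /lab_step[p [q [hp _]]]; rewrite /L addnS.
exact: (sum_poor_step lab_inj lab_neg hp x z g).
Qed.

Lemma sum_sym_part (C : pred {set T * T}) (Cp : pred {set {set T}})
    (F : {set T * T} -> R) :
  (forall P, setpart P -> symarcs lab neg (arcs lab P) -> Cp P = C (arcs lab P)) ->
  \sum_(P | sym_part lab neg P && Cp P) F (arcs lab P) =
  \sum_(A | symarcs lab neg A && C A) F A.
Proof.
move=> hC; under [RHS]eq_bigl => A do rewrite /symarcs -andbA.
rewrite -(sum_arcs lab_inj); apply: eq_bigl => P.
rewrite /sym_part /arc_symmetric /no_selfsym_arc.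
case hP: (setpart P) => //=.
have -> : [forall a, forall b, is_arc lab P a b == is_arc lab P (neg b) (neg a)] =
   [forall a, forall b, ((a, b) \in arcs lab P) == ((neg b, neg a) \in arcs lab P)].
  by apply: eq_forallb => a; apply: eq_forallb => b; rewrite !arcsE.
have -> : [forall a, ~~ is_arc lab P (neg a) a] = [forall a, (neg a, a) \notin arcs lab P].
  by apply: eq_forallb => a; rewrite arcsE.
case h1: [forall a, forall b, _] => //=; case h2: [forall a, _] => //=.
by apply: hC => //; rewrite /symarcs (arcs_arcset lab_inj hP) h1 h2.
Qed.

Lemma nc_symE P : nc_sym lab neg P = nc lab neg (arcs lab P).
Proof. by do 4 (apply: eq_forallb => ?); rewrite !arcsE. Qed.

Lemma poor_poorly P : setpart P -> poor P = poorly lab false (arcs lab P).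
Proof. exact: poorE. Qed.

(** A nonzero point [b] with neighbours a < b < c gives three nonzero points in its block even if a
    or c is 0: the mirror of the arc joining 0 and [b] then brings in -b. *)
Lemma Bpoor_poorly P : setpart P -> symarcs lab neg (arcs lab P) ->
  Bpoor lab P = poorly lab true (arcs lab P).
Proof.
move=> hP /and3P[_ /forallP mir _].
have {}mir a b : (a, b) \in arcs lab P -> (neg b, neg a) \in arcs lab P.
  by have /eqP <- := forallP (mir a) b.
apply/forall_inP/forallP => [h b|h B BP].
  case: (eqVneq (lab b) 0) => //= b0; apply/negP => /andP[/has_inP[a ab] /has_outP[c bc]].
  have three u v w : u \in pblock P b -> v \in pblock P b -> w \in pblock P b ->
      lab u != 0 -> lab v != 0 -> lab w != 0 -> lab u < lab v -> lab v < lab w -> False.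
    move=> ub vb wb u0 v0 w0 uv vw.
    have := h _ (pblock_in hP b); rewrite leqNgt => /negP; apply.
    apply/card_gt2P; exists u, v, w; rewrite !inE ub vb wb u0 v0 w0; split=> //.
    by split; apply/eqP => e; subst; move: uv vw; clear; lia.
  have ms := mir _ _ ab; have mt := mir _ _ bc.
  have [ab1 ab2 _] := arcP _ _ _ _ ab; have [bc1 bc2 _] := arcP _ _ _ _ bc.
  have [ms1 _ _] := arcP _ _ _ _ ms; have [mt1 _ _] := arcP _ _ _ _ mt.
  have ha := pblock_sym hP ab1; have hb := pblock_refl hP b.
  case: (eqVneq (lab a) 0) => a0.
    have e : neg a = a by apply: lab_inj; rewrite lab_neg a0.
    apply: (three (neg b) b c) => //; rewrite ?lab_neg; try by move: ab2 bc2 a0; clear; lia.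
    by have := pblock_sym hP ms1; rewrite e (pblock_eq hP ha).
  case: (eqVneq (lab c) 0) => c0; last exact: (three a b c).
  have e : neg c = c by apply: lab_inj; rewrite lab_neg c0.
  apply: (three a b (neg b)) => //; rewrite ?lab_neg; try by move: ab2 bc2 c0; clear; lia.
  by move: mt1; rewrite e (pblock_eq hP bc1).
have /set0Pn[t tB] : B != set0.
  by apply: contraTneq BP => ->; case/and3P: hP.
rewrite leqNgt; apply/negP => hB.
have sB : nonzero_part lab B \subset pblock P t.
  by apply/subsetP => u; rewrite inE -(blockE hP BP tB) => /andP[].
have [b] := middle_exists lab_inj hP sB hB.
by rewrite inE => /andP[_ b0] hb; have := h b; rewrite hb (negbTE b0).
Qed.

(** A block {0, t} cannot occur, as the mirror of its arc would put -t into it. So a single nonzero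
    element is isolated, and it or its mirror image is positive. *)
Lemma Bfeasible_singles P : setpart P -> symarcs lab neg (arcs lab P) ->
  Bfeasible lab P = (#|singles lab (m0 + n) (arcs lab P)| == 0%N).
Proof.
move=> hP hs; have vA := hs; rewrite -valid_top in vA.
have [_ [mir _ _]] := validP _ _ _ _ vA.
rewrite cards_eq0; apply/forall_inP/eqP => [h|h B BP].
  apply/setP => t; rewrite !inE within_top /=; apply/negP => /and3P[t0 it ot].
  have /negP := h _ (pblock_in hP t); apply.
  apply/cards1P; exists t; apply/setP => u; rewrite !inE.
  apply/andP/eqP => [[ut u0]|->]; last by rewrite pblock_refl //; move: t0; clear; lia.
  apply: lab_inj; case: (ltgtP (lab u) (lab t)) => // l.
    have [||w hw] := @pred_exists _ lab P hP u t; rewrite ?(pblock_eq hP ut) ?pblock_refl //.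
    by case/negP: it; apply/has_inP; exists w.
  have [w hw _] := succ_exists ut l.
  by case/negP: ot; apply/has_outP; exists w.
apply/negP => /cards1P[t eB].
have : t \in nonzero_part lab B by rewrite eB set11.
rewrite inE => /andP[tB t0].
have eu u : u \in B -> lab u != 0 -> u = t.
  by move=> uB u0; apply/eqP; rewrite -in_set1 -eB inE uB.
have eP := blockE hP BP tB.
have noarc u v : (u, v) \in arcs lab P -> (u == t) || (v == t) -> False.
  move=> uv h'; have [v1 v2 _] := arcP _ _ _ _ uv.
  have [uB vB] : u \in B /\ v \in B.
    case/orP: h' => /eqP e; first by rewrite -e in eP *; rewrite eP pblock_refl.
    by rewrite eP -e (pblock_eq hP v1) v1 pblock_refl.
  have [w1 _ _] := arcP _ _ _ _ (etrans (esym (mir u v)) uv).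
  have nt : neg t \in B.
    case: (eqVneq (lab u) 0) => u0; case: (eqVneq (lab v) 0) => v0.
    - by move: v2; rewrite u0 v0.
    - have e : neg u = u by apply: lab_inj; rewrite lab_neg u0.
      rewrite -(eu _ vB v0) (blockE hP BP uB).
      by apply: (pblock_sym hP); rewrite -{1}e.
    - have e : neg v = v by apply: lab_inj; rewrite lab_neg v0.
      by rewrite -(eu _ uB u0) (blockE hP BP vB) -e.
    - by move: v2; rewrite (eu _ uB u0) (eu _ vB v0) ltxx.
  have := eu _ nt; rewrite lab_neg oppr_eq0 => /(_ t0) e.
  by have := lab_neg t; rewrite e; move: t0; clear; lia.
have iso : ~~ has_in (arcs lab P) t && ~~ has_out (arcs lab P) t.
  apply/andP; split; apply/negP.
    by move=> /has_inP[u hu]; apply: (noarc _ _ hu); rewrite eqxx orbT.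
  by move=> /has_outP[u hu]; apply: (noarc _ _ hu); rewrite eqxx.
case/andP: iso => it ot; case: (ltrP 0 (lab t)) => l.
  by have := in_set0 t; rewrite -h inE within_top l it ot.
have := in_set0 (neg t); rewrite -h inE within_top lab_neg oppr_gt0.
rewrite (has_in_neg lab_inj lab_neg (neg t) vA) (mirrorK lab_inj lab_neg) ot.
rewrite -(has_in_neg lab_inj lab_neg t vA) it.
by rewrite lt_neqAle t0 l.
Qed.

End MirrorSums.

(** * The generating functions *)

Section Labels.
Variable n : nat.

Lemma labA_inj : injective (@labA n).
Proof. by move=> i j; rewrite /labA => h; apply: val_inj; move: h => /=; lia. Qed.

Lemma labA_bounds t : 0 < @labA n t <= n%:Z.
Proof. by rewrite /labA; have := ltn_ord t; lia. Qed.

Lemma labB_inj : injective (@labB n).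
Proof. by move=> i j; rewrite /labB => h; apply: val_inj; move: h => /=; lia. Qed.

Lemma labB_neg t : @labB n (@negB n t) = - @labB n t.
Proof. by rewrite /labB /=; have := ltn_ord t; lia. Qed.

Lemma labB_onto i : (0 <= i <= 0 + n)%N -> exists t, @labB n t = i%:Z.
Proof.
move=> hi; have h : (i + n < 2 * n + 1)%N by lia.
by exists (Ordinal h); rewrite /labB /=; lia.
Qed.

Lemma labB_base t : within (@labB n) 0 t -> `|@labB n t|%N = 0%N.
Proof. by rewrite /within; lia. Qed.

Lemma labB_top t : within (@labB n) (0 + n) t.
Proof. by rewrite /within /labB; have := ltn_ord t; lia. Qed.

Lemma labD_inj : injective (@labD n.+1).
Proof.
move=> i j; rewrite /labD => h; apply: val_inj; move: h => /=.
by do 2 case: ifP; lia.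
Qed.

Lemma labD_neg t : @labD n.+1 (@negD n.+1 t) = - @labD n.+1 t.
Proof. by rewrite /labD /= -/(2 * n.+1)%N; have := ltn_ord t; do 2 case: ifP; lia. Qed.

Lemma labD_onto i : (1 <= i <= 1 + n)%N -> exists t, @labD n.+1 t = i%:Z.
Proof.
move=> hi; have h : (i + n < 2 * n.+1)%N by lia.
by exists (Ordinal h); rewrite /labD /=; case: ifP; lia.
Qed.

Lemma labD_neq0 t : @labD n.+1 t != 0.
Proof. by rewrite /labD; case: ifP; lia. Qed.

Lemma labD_base t : within (@labD n.+1) 1 t -> `|@labD n.+1 t|%N = 1%N.
Proof. by have := labD_neq0 t; rewrite /within; lia. Qed.

Lemma labD_top t : within (@labD n.+1) (1 + n) t.
Proof. by rewrite /within /labD; have := ltn_ord t; case: ifP; lia. Qed.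

Lemma outer_first_B b : exists2 t, @labB n t = 0 & outer_first (@labB n) b 0 = [:: t].
Proof.
have [t ht] := @labB_onto 0 isT.
by exists t => //=; rewrite -[RHS](points_at_lab labB_inj) ht.
Qed.

Lemma outer_first_D : exists t u,
  [/\ @labD n.+1 t = 1, @labD n.+1 u = -1 & outer_first (@labD n.+1) true 1 = [:: t; u]].
Proof.
have [t ht] := @labD_onto 1 isT; exists t, (@negD n.+1 t).
rewrite labD_neg ht; split=> //=.
have h := points_at_lab labD_inj.
have := h t; have := h (@negD n.+1 t); rewrite labD_neg ht => -> ->.
have [->|[u hu _]] := points_atP labD_inj 0; first by [].
by have := labD_neq0 u; rewrite hu.
Qed.

End Labels.

Section Evaluation.
Variable R : comNzRingType.
Implicit Types (x y : R) (n : nat).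

Let none (p : nat * nat) : R := (p.1 == 0%N)%:R.

Lemma sum_lone n x (f : nat * nat -> R) :
  \sum_(A | arcset (@labA n) A) x ^+ #|A| * f (#|lone (@labA n) n A|, #|closing (@labA n) n A|)
  = iter n (singleton_op 1 x) f (0%N, 0%N).
Proof.
pose L i f := \sum_(A | below (@labA n) i A)
  x ^+ #|A| * f (#|lone (@labA n) i A|, #|closing (@labA n) i A|).
have pos t : 0 < @labA n t by case/andP: (labA_bounds t).
transitivity (L n f).
  apply: eq_bigl => A; rewrite /below; case: (arcset _ _) => //=.
  by symmetry; apply/forall_inP => e _; case/andP: (labA_bounds e.2).
rewrite (@iter_levels _ _ L (singleton_op 1 x)).
  rewrite /L (big_pred1 set0) => [|A] /=.
    rewrite cards0 mul1r; congr (iter _ _ _ (_, _)); apply/eqP;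
      rewrite cards_eq0 -subset0; apply/subsetP => t; rewrite inE => /andP[h _];
      by have := pos t; move: h; lia.
  apply/idP/eqP => [/belowP[_ bnd]|->].
    apply/eqP; rewrite -subset0; apply/subsetP => -[a b] /bnd h.
    by have := pos b; move: h; lia.
  apply/belowP; split; first split.
  - by move=> a b; rewrite inE.
  - by move=> a b c; rewrite inE.
  - by move=> a b c; rewrite inE.
  - by move=> a b; rewrite inE.
move=> i g hi; apply: (sum_lone_step (@labA_inj n) (p := Ordinal hi)).
by rewrite /labA /=; lia.
Qed.

Lemma Bell_iter n x : Bell n x = iter n (singleton_op 1 x) (fun _ => 1) (0%N, 0%N).
Proof.
rewrite -sum_lone /Bell.
under [RHS]eq_bigr => A _ do rewrite mulr1.
under [RHS]eq_bigl => A do rewrite -[arcset _ _]andbT.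
rewrite -(sum_arcs (@labA_inj n) predT (fun A => x ^+ #|A|)).
by apply: eq_bigl => P; rewrite andbT.
Qed.

Lemma Fe_iter n x : Fe n x = iter n (singleton_op 1 x) none (0%N, 0%N).
Proof.
rewrite -sum_lone /Fe.
pose C (A : {set 'I_n * 'I_n}) := [forall t, has_in A t || has_out A t].
transitivity (\sum_(A | arcset (@labA n) A && C A) x ^+ #|A|).
  rewrite -(sum_arcs (@labA_inj n) C); apply: eq_bigl => P.
  by case hP: (setpart P) => //=; rewrite (feasibleE (@labA_inj n) hP).
rewrite big_mkcondr; apply: eq_bigr => A _; rewrite /none /=.
suff -> : C A = (#|lone (@labA n) n A| == 0%N) by case: eqP; rewrite ?mulr1 ?mulr0.
rewrite cards_eq0; apply/forallP/eqP => [h|h t].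
  apply/setP => t; rewrite !inE; have := h t.
  by case: (has_in A t); case: (has_out A t); rewrite ?andbF.
have := in_set0 t; rewrite -h inE.
have /andP[_ ->] := labA_bounds t.
by case: (has_in A t); case: (has_out A t).
Qed.

Lemma BellB2_iter n x y : BellB2 n x y = iter n (add_scalar (block_op 2 x) y) (fun _ => 1) 0%N.
Proof.
have := sum_block (@labB_inj n) (@labB_neg n) (@labB_onto n)
  (@labB_base n) (@labB_top n) x y (fun _ => 1).
have [t _ ->] := outer_first_B n true; rewrite /= (@block_op_shift R x y) // => <-.
under [RHS]eq_bigr => A _ do rewrite mulr1.
under [RHS]eq_bigl => A do rewrite -[symarcs _ _ _]andbT.
rewrite -(sum_sym_part (@labB_inj n) (C := predT) (Cp := predT)) //.
by apply: eq_bigl => P; rewrite andbT.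
Qed.

(** The base level has two available points, one of which [block_op_shift] leaves out. *)
Lemma BellD2_iter n x y :
  BellD2 n.+1 x y = iter n (add_scalar (block_op 2 x) y) (fun _ => 1) 1%N.
Proof.
have := sum_block (@labD_inj n) (@labD_neg n) (@labD_onto n)
  (@labD_base n) (@labD_top n) x y (fun _ => 1).
have [t [u [_ _ ->]]] := outer_first_D n; rewrite /= (@block_op_shift R x y) // => <-.
under [RHS]eq_bigr => A _ do rewrite mulr1.
under [RHS]eq_bigl => A do rewrite -[symarcs _ _ _]andbT.
rewrite -(sum_sym_part (@labD_inj n) (C := predT) (Cp := predT)) //.
by apply: eq_bigl => P; rewrite andbT.
Qed.

Lemma BellB_iter n x : BellB n x = iter n (block_op 2 x) (fun _ => 1) 1%N.
Proof.
(* For y = x the largest point weighs like the others and can be counted again, so the state 1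
   replaces 0 and the scalar disappears. *)
rewrite /BellB BellB2_iter (@block_op_shift R x x) // => g b.
by rewrite /block_op -natr1; ring.
Qed.

Lemma FeBt_iter n x : FeBt n x = iter n (singleton_op 2 x) none (0%N, 1%N).
Proof.
have := sum_singleton (@labB_inj n) (@labB_neg n) (@labB_onto n)
  (@labB_base n) (@labB_top n) x none.
have [z hz _] := outer_first_B n true.
have -> : #|singles (@labB n) 0 set0| = 0%N.
  apply/eqP; rewrite cards_eq0 -subset0; apply/subsetP => t; rewrite !inE.
  by rewrite /within; lia.
have -> : #|others (@labB n) 0 set0| = 1%N.
  apply/eqP/cards1P; exists z; apply/setP => t; rewrite !inE has_out_set0 has_in_set0.
  by rewrite (eq_lab (@labB_inj n)) hz /within; lia.
move=> <-; rewrite /FeBt.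
pose C (A : {set 'I_(2 * n + 1) * 'I_(2 * n + 1)}) := #|singles (@labB n) (0 + n) A| == 0%N.
transitivity (\sum_(A | symarcs (@labB n) (@negB n) A && C A) x ^+ (#|A| %/ 2)).
  rewrite -(sum_sym_part (@labB_inj n) (C := C) (Cp := @Bfeasible _ (@labB n))) //.
  move=> P hP hs.
  exact: (Bfeasible_singles (@labB_inj n) (@labB_neg n) (@labB_top n) hP hs).
rewrite big_mkcondr; apply: eq_bigr => A _; rewrite /none /C /=.
by case: eqP; rewrite ?mulr1 ?mulr0.
Qed.

Lemma CatB2_iter n x y :
  CatB2 n x y = iter n (add_scalar (fold_op x) (1 + y)) (delta0 R) 0%N.
Proof.
have := sum_nc (@labB_inj n) (@labB_neg n) (@labB_onto n)
  (@labB_base n) (@labB_top n) x y.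
have [t _ ->] := outer_first_B n true => /= <-.
rewrite -(sum_sym_part (@labB_inj n) (C := nc (@labB n) (@negB n))
  (Cp := nc_sym (@labB n) (@negB n))) // => P _ _.
exact: nc_symE.
Qed.

(** Without its head 1, the base list consists of the negative point -1, which may be chosen or not;
    this gives the heights 1 and 0. *)
Lemma CatD2_iter n x y :
  CatD2 n.+1 x y = iter n (add_scalar (fold_op x) (1 + y)) (delta0 R) 0%N +
                   iter n (add_scalar (fold_op x) (1 + y)) (delta0 R) 1%N.
Proof.
have := sum_nc (@labD_inj n) (@labD_neg n) (@labD_onto n)
  (@labD_base n) (@labD_top n) x y.
have [t [u [ht hu ->]]] := outer_first_D n; rewrite /= hu => /= <-.
rewrite -(sum_sym_part (@labD_inj n) (C := nc (@labD n.+1) (@negD n.+1))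
  (Cp := nc_sym (@labD n.+1) (@negD n.+1))) // => P _ _.
exact: nc_symE.
Qed.

Lemma MoB_iter n x : MoB n x = iter n (add_scalar (fold_op x) 1) (delta0 R) 0%N.
Proof.
have := sum_poor (@labB_inj n) (@labB_neg n) (@labB_onto n)
  (@labB_base n) (@labB_top n) x false.
have [t ht ->] := outer_first_B n false; rewrite /= ht eqxx /= => <-.
rewrite -(sum_sym_part (@labB_inj n)
  (C := fun A => nc (@labB n) (@negB n) A && poorly (@labB n) false A)
  (Cp := fun P => nc_sym (@labB n) (@negB n) P && poor P)).
  by apply: eq_bigl => P; rewrite -andbA.
by move=> P hP _; rewrite nc_symE (poor_poorly (@labB_inj n) hP).
Qed.

(** Unlike in the poor case, the point 0 is in the base list, and choosing it or not gives the
    heights 1 and 0, as -1 does in type D. *)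
Lemma MoBt_iter n x :
  MoBt n x = iter n (add_scalar (fold_op x) 1) (delta0 R) 0%N +
             iter n (add_scalar (fold_op x) 1) (delta0 R) 1%N.
Proof.
have := sum_poor (@labB_inj n) (@labB_neg n) (@labB_onto n)
  (@labB_base n) (@labB_top n) x true.
have [t ht ->] := outer_first_B n false; rewrite /= ht eqxx /= ht lexx => <-.
rewrite -(sum_sym_part (@labB_inj n)
  (C := fun A => nc (@labB n) (@negB n) A && poorly (@labB n) true A)
  (Cp := fun P => nc_sym (@labB n) (@negB n) P && Bpoor (@labB n) P)).
  by apply: eq_bigl => P; rewrite -andbA.
move=> P hP hs; rewrite nc_symE.
by rewrite (Bpoor_poorly (@labB_inj n) (@labB_neg n) hP hs).
Qed.

End Evaluation.

Theorem theorem6p7 (R : comNzRingType) (n : nat) (x y : R) :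
  (BellB2 n x y = \sum_(k < n.+1) 'C(n, k)%:R * Bell k (2 * x) * y ^+ (n - k)
   /\ BellB2 n x y
      = \sum_(k < n.+1) 'C(n, k)%:R * Fe k (2 * x) * (y + 1) ^+ (n - k))
  /\
  (BellD2 n.+1 x y = \sum_(k < n.+1) 'C(n, k)%:R * BellB k x * y ^+ (n - k)
   /\ BellD2 n.+1 x y
      = \sum_(k < n.+1) 'C(n, k)%:R * FeBt k x * (y + 1) ^+ (n - k))
  /\
  (CatB2 n x y = \sum_(k < n.+1) 'C(n, k)%:R * MoB k x * y ^+ (n - k)
   /\ CatB2 n x y
      = \sum_(k < n.+1)
          'C(2 * k, k)%:R * 'C(n, 2 * k)%:R * x ^+ k * (y + 1) ^+ (n - 2 * k))
  /\
  (CatD2 n.+1 x y = \sum_(k < n.+1) 'C(n, k)%:R * MoBt k x * y ^+ (n - k)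
   /\ CatD2 n.+1 x y
      = \sum_(k < n.+1)
          'C(n, k)%:R * 'C(k, k./2)%:R * x ^+ (uphalf k) * (y + 1) ^+ (n - k)).
Proof.
have eB : BellB2 n x y =
    iter n (add_scalar (singleton_op 1 (2 * x)) y) (fun _ => 1) (0%N, 0%N).
  rewrite BellB2_iter (singleton_block_op 1 (2 * x) y n (fun _ => 1) (0%N, 0%N)).
  exact: (block_op_double x y n 0).
have eD : BellD2 n.+1 x y =
    iter n (add_scalar (singleton_op 2 x) y) (fun _ => 1) (0%N, 1%N).
  by rewrite BellD2_iter (singleton_block_op 2 x y n (fun _ => 1) (0%N, 1%N)).
(* The scalar 1 is kept inside the operator of the poor partitions and only y is expanded; for the
   closed formulas the whole of 1 + y is expanded around [fold_op]. *)
have eC h : iter n (add_scalar (fold_op x) (1 + y)) (delta0 R) h =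
  \sum_(k < n.+1) 'C(n, k)%:R * iter k (add_scalar (fold_op x) 1) (delta0 R) h * y ^+ (n - k).
  rewrite -iter_add_scalar; first last.
  - exact/add_scalar_linear/fold_op_linear.
  - exact/add_scalar_ext/fold_op_ext.
  apply: eq_iter_op; first exact/add_scalar_ext/fold_op_ext.
  by move=> f s; rewrite /add_scalar; ring.
split; [|split; [|split]]; split.
- rewrite eB (iter_add_scalar y n _ _ (@singleton_op_ext _ 1 (2 * x))
    (@singleton_op_linear _ 1 (2 * x))).
  by apply: eq_bigr => k _; rewrite Bell_iter.
- rewrite eB singleton_op_transform.
  rewrite (iter_add_scalar (y + 1) n _ _ (@singleton_op_ext _ 1 (2 * x))
    (@singleton_op_linear _ 1 (2 * x))).
  by apply: eq_bigr => k _; rewrite Fe_iter.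
- rewrite BellD2_iter (iter_add_scalar y n _ _ (@block_op_ext _ 2 x) (@block_op_linear _ 2 x)).
  by apply: eq_bigr => k _; rewrite BellB_iter.
- rewrite eD singleton_op_transform.
  rewrite (iter_add_scalar (y + 1) n _ _ (@singleton_op_ext _ 2 x)
    (@singleton_op_linear _ 2 x)).
  by apply: eq_bigr => k _; rewrite FeBt_iter.
- by rewrite CatB2_iter eC; apply: eq_bigr => k _; rewrite MoB_iter.
- by rewrite CatB2_iter iter_fold_op0 [y + 1]addrC.
- rewrite CatD2_iter !eC -big_split; apply: eq_bigr => k _.
  by rewrite MoBt_iter /= mulrDr mulrDl.
- by rewrite CatD2_iter iter_fold_op01 [y + 1]addrC.
Qed.
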